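(* Let $\mathfrak{K}(y)=y^\alpha$, $\alpha>0$, and let $u_\alpha(x)$, $x\geq 0$, be the function defining the graph of the rotational $\mathfrak{K}$-surface $\Sigma_{u_\alpha}$ intersecting orthogonally the axis of rotation with upwards orientation. 1. If $\alpha>2$, then $$u_\alpha(x)=\int_0^x\sqrt{\left(\frac{\alpha-2}{2}t^2+1\right)^{\frac{2}{\alpha-2}}-1}\;dt.$$ In particular, $u_\alpha(x)$ is defined for every $x\geq 0$, $\Sigma_{u_\alpha}$ is an entire graph, and $$\lim_{x\to\infty}\frac{u_\alpha(x)}{x^{\boldsymbol{n}(\alpha)}}=C>0,\qquad \boldsymbol{n}(\alpha):=\frac{\alpha}{\alpha-2}.$$ 2. If $\alpha=2$, then $$u_2(x)=\int_0^x\sqrt{e^{\frac{t^2}{2}}-1}\;dt.$$ In particular, $u_2(x)$ is defined for every $x\geq 0$ and $\Sigma_{u_2}$ is an entire graph. 3. If $\alpha<2$, then $$u_\alpha(x)=\int_0^x\sqrt{\left(\frac{2R_\alpha}{2R_\alpha-t^2}\right)^{\frac{2-\alpha}{2}}-1}\;dt,$$ where $R_\alpha:=1/(2-\alpha)$. In particular, $u_\alpha(x)$ is defined for $x\in[0,\sqrt{2R_\alpha})$ and $\Sigma_{u_\alpha}$ converges to the flat cylinder of radius $\sqrt{2R_\alpha}$ and vertical rulings.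
   Context: An immersed, oriented surface $\Sigma$ in $\mathbb{R}^3$ with Gauss map $\eta$ is a $\mathfrak{K}$-surface if its Gauss curvature satisfies $K_\Sigma(p)=\mathfrak{K}(\langle\eta_p,e_3\rangle)$ for every $p\in\Sigma$, where $e_3=(0,0,1)$. For a function $u$, $\Sigma_u$ denotes the surface obtained by rotating the graph $(x,0,u(x))$ around the $z$-axis, which is the axis of rotation; with upwards orientation its angle function $\langle\eta,e_3\rangle$ is $1/\sqrt{1+u'(x)^2}$, and the condition of being a $\mathfrak{K}$-surface reads $$\frac{u''u'}{x(1+u'^2)^2}=\mathfrak{K}\left(\frac{1}{\sqrt{1+u'^2}}\right).$$ Intersecting the axis of rotation orthogonally means $u'(0)=0$; since the problem is invariant under vertical translations, the graph is normalized by $u(0)=0$, and the solution with $u\geq 0$ is taken. A graph is entire if it is defined over the whole horizontal plane.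
   Formalization: Two printed formulas do not solve the curvature equation at the axis and are corrected: for α=2 the integrand has e^{t²} instead of e^{t²/2}, and for α<2 the exponent is 2/(2−α) instead of (2−α)/2. *)

(* Defs.v *)
From Stdlib Require Import Reals Lra.
From Coquelicot Require Import Coquelicot.
Open Scope R_scope.

Definition vec3 := (R * R * R)%type.
Definition px (p : vec3) : R := fst (fst p).
Definition py (p : vec3) : R := snd (fst p).
Definition pz (p : vec3) : R := snd p.

Definition e3 : vec3 := (0, 0, 1).
Definition vsub (p q : vec3) : vec3 := (px p - px q, py p - py q, pz p - pz q).
Definition scal3 (k : R) (p : vec3) : vec3 := (k * px p, k * py p, k * pz p).
Definition dot (p q : vec3) : R := px p * px q + py p * py q + pz p * pz q.
Definition norm3 (p : vec3) : R := sqrt (dot p p).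
Definition cross (p q : vec3) : vec3 :=
  (py p * pz q - pz p * py q,
   pz p * px q - px p * pz q,
   px p * py q - py p * px q).

(* A surface is given by one global parametrization X over a region D of the
   plane, which is enough for graphs and for cylinders.  It carries the
   orientation induced by X, i.e. the Gauss map is X_a x X_b / |X_a x X_b|. *)
Definition surface := R -> R -> vec3.
Definition region := R -> R -> Prop.

Definition Da (X : surface) : surface := fun a b =>
  (Derive (fun s => px (X s b)) a,
   Derive (fun s => py (X s b)) a,
   Derive (fun s => pz (X s b)) a).
Definition Db (X : surface) : surface := fun a b =>
  (Derive (fun s => px (X a s)) b,
   Derive (fun s => py (X a s)) b,
   Derive (fun s => pz (X a s)) b).

Definition gauss_map (X : surface) : surface := fun a b =>
  scal3 (/ norm3 (cross (Da X a b) (Db X a b))) (cross (Da X a b) (Db X a b)).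

Definition ffE (X : surface) (a b : R) : R := dot (Da X a b) (Da X a b).
Definition ffF (X : surface) (a b : R) : R := dot (Da X a b) (Db X a b).
Definition ffG (X : surface) (a b : R) : R := dot (Db X a b) (Db X a b).
Definition sfe (X : surface) (a b : R) : R := dot (gauss_map X a b) (Da (Da X) a b).
Definition sff (X : surface) (a b : R) : R := dot (gauss_map X a b) (Da (Db X) a b).
Definition sfg (X : surface) (a b : R) : R := dot (gauss_map X a b) (Db (Db X) a b).
Definition gauss_curvature (X : surface) (a b : R) : R :=
  (sfe X a b * sfg X a b - sff X a b ^ 2) / (ffE X a b * ffG X a b - ffF X a b ^ 2).
Definition mean_curvature (X : surface) (a b : R) : R :=
  (sfe X a b * ffG X a b - 2 * sff X a b * ffF X a b + sfg X a b * ffE X a b) /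
  (2 * (ffE X a b * ffG X a b - ffF X a b ^ 2)).

Definition angle_function (X : surface) (a b : R) : R := dot (gauss_map X a b) e3.

Definition open_region (D : region) : Prop := forall a b, D a b -> locally_2d D a b.

(* Required at every point of an open region, [ex_diff_n _ 2] is class C^2. *)
Definition immersed_surface (D : region) (X : surface) : Prop :=
  open_region D /\
  forall a b, D a b ->
    ex_diff_n (fun s t => px (X s t)) 2 a b /\
    ex_diff_n (fun s t => py (X s t)) 2 a b /\
    ex_diff_n (fun s t => pz (X s t)) 2 a b /\
    cross (Da X a b) (Db X a b) <> (0, 0, 0).

Definition K_surface (frakK : R -> R) (D : region) (X : surface) : Prop :=
  immersed_surface D X /\
  forall a b, D a b -> gauss_curvature X a b = frakK (angle_function X a b).

Definition upwards_oriented (D : region) (X : surface) : Prop :=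
  forall a b, D a b -> 0 < angle_function X a b.

Definition entire_graph (D : region) (X : surface) : Prop :=
  (forall a b, D a b) /\ (exists v : R -> R -> R, forall a b, X a b = (a, b, v a b)).

Definition axis_disc (r : Rbar) : region := fun a b =>
  Rbar_lt (Finite (sqrt (a ^ 2 + b ^ 2))) r.

(* Rotating the curve x |-> (x, 0, u x), 0 <= x < r, around the z-axis gives the
   graph of (a, b) |-> u |(a, b)| over [axis_disc r] (see [rot_surface_orbit]).  Only
   the values of u on [0, r) matter. *)
Definition rot_surface (u : R -> R) : surface := fun a b =>
  (a, b, u (sqrt (a ^ 2 + b ^ 2))).

Definition rotz (theta : R) (p : vec3) : vec3 :=
  (cos theta * px p - sin theta * py p,
   sin theta * px p + cos theta * py p,
   pz p).

Lemma unit_circle_angle (c s : R) :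
  c ^ 2 + s ^ 2 = 1 -> exists theta, cos theta = c /\ sin theta = s.
Proof.
intros H.
assert (Hc : -1 <= c <= 1) by (split; nra).
assert (E : sqrt (1 - Rsqr c) = Rabs s).
{ rewrite <- sqrt_Rsqr_abs. f_equal. unfold Rsqr. nra. }
destruct (Rle_dec 0 s) as [Hs | Hs].
- exists (acos c). rewrite cos_acos, sin_acos, E, Rabs_pos_eq; auto.
- exists (- acos c). rewrite cos_neg, sin_neg, cos_acos, sin_acos, E; auto.
  rewrite Rabs_left; lra.
Qed.

Lemma rot_surface_orbit (r : Rbar) (u : R -> R) (p : vec3) :
  (exists a b, axis_disc r a b /\ p = rot_surface u a b) <->
  (exists x theta, 0 <= x /\ Rbar_lt (Finite x) r /\ p = rotz theta (x, 0, u x)).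
Proof.
unfold axis_disc, rot_surface, rotz, px, py, pz; split.
- intros (a & b & Hd & ->); simpl fst; simpl snd.
  set (x := sqrt (a ^ 2 + b ^ 2)) in *.
  assert (Hx : 0 <= x) by apply sqrt_pos.
  assert (Hx2 : x * x = a ^ 2 + b ^ 2) by (apply sqrt_sqrt; nra).
  destruct (Req_dec x 0) as [H0 | H0].
  + exists x, 0. repeat split; auto.
    replace a with 0 by nra. replace b with 0 by nra. rewrite H0.
    f_equal. f_equal; ring.
  + destruct (unit_circle_angle (a / x) (b / x)) as (th & Hc & Hs).
    { replace ((a / x) ^ 2 + (b / x) ^ 2) with ((a ^ 2 + b ^ 2) / (x * x))
        by (field; auto).
      rewrite <- Hx2. field; auto. }
    exists x, th. repeat split; auto.
    rewrite Hc, Hs. f_equal. f_equal; field; auto.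
- intros (x & th & Hx & Hr & ->); simpl fst; simpl snd.
  exists (x * cos th), (x * sin th).
  replace ((x * cos th) ^ 2 + (x * sin th) ^ 2) with (x * x).
  + rewrite sqrt_square by auto. split; auto.
    f_equal. f_equal; ring.
  + generalize (sin2_cos2 th). unfold Rsqr. intros H. nra.
Qed.

(* u : [0, r) -> R defines the graph of a rotational K-surface meeting the axis
   of rotation orthogonally, with upwards orientation, normalized by u(0) = 0
   and u >= 0.  The condition u'(0) = 0 is a one-sided derivative. *)
Definition rotational_K_graph (frakK : R -> R) (r : Rbar) (u : R -> R) : Prop :=
  Rbar_lt (Finite 0) r /\
  K_surface frakK (axis_disc r) (rot_surface u) /\
  upwards_oriented (axis_disc r) (rot_surface u) /\
  u 0 = 0 /\
  filterlim (fun x => (u x - u 0) / x) (at_right 0) (locally 0) /\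
  (forall x, 0 <= x -> Rbar_lt (Finite x) r -> 0 <= u x).

(* "The" function u defining the graph is the one that cannot be extended to a
   larger interval [0, r'). *)
Definition maximal_rotational_K_graph (frakK : R -> R) (r : Rbar) (u : R -> R) : Prop :=
  rotational_K_graph frakK r u /\
  forall (r' : Rbar) (v : R -> R),
    rotational_K_graph frakK r' v ->
    Rbar_le r r' ->
    (forall x, 0 <= x -> Rbar_lt (Finite x) r -> v x = u x) ->
    r' = r.

(* The flat cylinder of radius rho with vertical rulings, parametrized by
   height and angle in this order so that the normal points to the axis. *)
Definition vertical_cylinder (rho : R) : surface := fun z theta =>
  (rho * cos theta, rho * sin theta, z).

(* Second-order convergence of X to Y as the parameter leaves every compact
   subset of [axis_disc r]: points, unit normals and curvatures approach those of Y. *)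
Definition converges_to_surface (r : Rbar) (X Y : surface) : Prop :=
  forall eps : R, 0 < eps ->
  exists s : R, Rbar_lt (Finite s) r /\
  forall a b, axis_disc r a b -> s < sqrt (a ^ 2 + b ^ 2) ->
  exists a' b' : R,
    norm3 (vsub (X a b) (Y a' b')) < eps /\
    norm3 (vsub (gauss_map X a b) (gauss_map Y a' b')) < eps /\
    Rabs (gauss_curvature X a b - gauss_curvature Y a' b') < eps /\
    Rabs (mean_curvature X a b - mean_curvature Y a' b') < eps.

(* Main.v *)
Require Import Defs.
From Stdlib Require Import Reals Lra Psatz.
From Coquelicot Require Import Coquelicot.
Open Scope R_scope.

(** Put k = (alpha - 2) / 2 and w = 1 + u'^2.  Along the profile curve the curvature equation
    is w' = 2 x w^(1 - k), so that m = ln w satisfies (exp (k m))' = 2 k x.  Hence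
    exp (k m) = 1 + k x^2 and then m' = 2 x / (1 + k x^2), which determines w and, u' having
    constant sign, also u.  When k < 0 this forces 1 + k x^2 > 0, which bounds the radius.
    Conversely u is a C^2 function Phi of x^2, so the rotated surface is the graph of
    Phi (a^2 + b^2), which is of class C^2 on the axis too; its curvature is W' / W^2, where
    w = W (x^2).  As x tends to the maximal radius when k < 0, w tends to infinity, and normal
    and curvatures can be written in terms of w and x only. *)

(** The axis is the obstacle, in both directions. At x = 0 the curvature equation divides by x while
    u' vanishes, so standard uniqueness for regular ODEs does not apply there; the equation for m,
    in contrast, makes sense at x = 0 and can be integrated from the axis. Conversely u' = sqrt (w -
    1) is the square root of a function that vanishes at the axis. Dividing w - 1 by s = x^2 first
    leaves a positive function of s, whose root is smooth, and u' is x times this root; hence the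
    gradient of the rotated graph is (a, b) times a C^1 function of a^2 + b^2. Working with exp (k
    m) rather than with the power 1 / k keeps alpha = 2, that is k = 0, inside the same argument.
    The equation sees u' only through u'^2 and its derivative, so it does not distinguish u from -
    u; the condition u >= 0 makes the choice. The constant alpha is 2 (k + 1) throughout, because
    the angle function is w^(-1/2) and its power alpha is w^(-(k + 1)). *)

Lemma triple_eq (x y z x' y' z' : R) :
  x = x' -> y = y' -> z = z' -> (x, y, z) = (x', y', z').
Proof. now intros -> -> ->. Qed.

(** * Graphs and rotational graphs *)

Definition graph (f : R -> R -> R) : surface := fun a b => (a, b, f a b).

Section Graph.
Variable f : R -> R -> R.
Let p a b := Derive (fun s => f s b) a.
Let q a b := Derive (fun t => f a t) b.
Let w a b := 1 + p a b ^ 2 + q a b ^ 2.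

Lemma Da_graph a b : Da (graph f) a b = (1, 0, p a b).
Proof.
  unfold Da, graph, px, py, pz; simpl; apply triple_eq; [apply Derive_id | apply Derive_const | easy].
Qed.

Lemma Db_graph a b : Db (graph f) a b = (0, 1, q a b).
Proof.
  unfold Db, graph, px, py, pz; simpl; apply triple_eq; [apply Derive_const | apply Derive_id | easy].
Qed.

Lemma Da_Da_graph a b : Da (Da (graph f)) a b = (0, 0, Derive (fun s => p s b) a).
Proof.
  unfold Da at 1; apply triple_eq.
  - rewrite (Derive_ext _ (fun _ => 1)); [apply Derive_const | intros t; now rewrite Da_graph].
  - rewrite (Derive_ext _ (fun _ => 0)); [apply Derive_const | intros t; now rewrite Da_graph].
  - apply Derive_ext; intros t; now rewrite Da_graph.
Qed.

Lemma Da_Db_graph a b : Da (Db (graph f)) a b = (0, 0, Derive (fun s => q s b) a).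
Proof.
  unfold Da at 1; apply triple_eq.
  - rewrite (Derive_ext _ (fun _ => 0)); [apply Derive_const | intros t; now rewrite Db_graph].
  - rewrite (Derive_ext _ (fun _ => 1)); [apply Derive_const | intros t; now rewrite Db_graph].
  - apply Derive_ext; intros t; now rewrite Db_graph.
Qed.

Lemma Db_Db_graph a b : Db (Db (graph f)) a b = (0, 0, Derive (fun t => q a t) b).
Proof.
  unfold Db at 1; apply triple_eq.
  - rewrite (Derive_ext _ (fun _ => 0)); [apply Derive_const | intros t; now rewrite Db_graph].
  - rewrite (Derive_ext _ (fun _ => 1)); [apply Derive_const | intros t; now rewrite Db_graph].
  - apply Derive_ext; intros t; now rewrite Db_graph.
Qed.

Lemma cross_graph a b :
  cross (Da (graph f) a b) (Db (graph f) a b) = (- p a b, - q a b, 1).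
Proof.
  rewrite Da_graph, Db_graph; unfold cross, px, py, pz; simpl; apply triple_eq; ring.
Qed.

Lemma gauss_map_graph a b :
  gauss_map (graph f) a b =
  (- p a b / sqrt (w a b), - q a b / sqrt (w a b), / sqrt (w a b)).
Proof.
  unfold gauss_map; rewrite cross_graph.
  unfold norm3, dot, scal3, px, py, pz; simpl fst; simpl snd.
  replace (- p a b * - p a b + - q a b * - q a b + 1 * 1) with (w a b) by (unfold w; ring).
  apply triple_eq; unfold Rdiv; ring.
Qed.

Lemma angle_function_graph a b : angle_function (graph f) a b = / sqrt (w a b).
Proof.
  unfold angle_function; rewrite gauss_map_graph.
  unfold dot, e3, px, py, pz; simpl fst; simpl snd; ring.
Qed.

Lemma gauss_curvature_graph a b :
  gauss_curvature (graph f) a b =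
  (Derive (fun s => p s b) a * Derive (fun t => q a t) b
   - Derive (fun s => q s b) a ^ 2) / w a b ^ 2.
Proof.
  assert (Hw : 0 < w a b) by (unfold w; nra).
  pose proof (sqrt_lt_R0 _ Hw) as Hs.
  assert (Hs2 : sqrt (w a b) ^ 2 = w a b) by (apply pow2_sqrt; lra).
  unfold gauss_curvature, sfe, sff, sfg, ffE, ffF, ffG.
  rewrite gauss_map_graph, Da_Da_graph, Da_Db_graph, Db_Db_graph, Da_graph, Db_graph.
  unfold dot, px, py, pz; simpl fst; simpl snd.
  set (x := Derive (fun s => p s b) a). set (y := Derive (fun t => q a t) b).
  set (z := Derive (fun s => q s b) a).
  replace ((1 * 1 + 0 * 0 + p a b * p a b) * (0 * 0 + 1 * 1 + q a b * q a b)
           - (1 * 0 + 0 * 1 + p a b * q a b) ^ 2) with (w a b) by (unfold w; ring).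
  set (S := sqrt (w a b)) in *. rewrite <- Hs2. field. lra.
Qed.

Lemma mean_curvature_graph a b :
  mean_curvature (graph f) a b =
  (Derive (fun s => p s b) a * (1 + q a b ^ 2)
   - 2 * Derive (fun s => q s b) a * p a b * q a b
   + Derive (fun t => q a t) b * (1 + p a b ^ 2)) / (2 * sqrt (w a b) * w a b).
Proof.
  assert (Hw : 0 < w a b) by (unfold w; nra).
  pose proof (sqrt_lt_R0 _ Hw) as Hs.
  unfold mean_curvature, sfe, sff, sfg, ffE, ffF, ffG.
  rewrite gauss_map_graph, Da_Da_graph, Da_Db_graph, Db_Db_graph, Da_graph, Db_graph.
  unfold dot, px, py, pz; simpl fst; simpl snd.
  set (x := Derive (fun s => p s b) a). set (y := Derive (fun t => q a t) b).
  set (z := Derive (fun s => q s b) a).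
  replace ((1 * 1 + 0 * 0 + p a b * p a b) * (0 * 0 + 1 * 1 + q a b * q a b)
           - (1 * 0 + 0 * 1 + p a b * q a b) ^ 2) with (w a b) by (unfold w; ring).
  field. lra.
Qed.

End Graph.

Lemma continuity_2d_pt_sq_norm a b : continuity_2d_pt (fun x y => x ^ 2 + y ^ 2) a b.
Proof.
  apply continuity_2d_pt_ext with (f := fun x y => x * x + y * y); [intros; ring |].
  apply continuity_2d_pt_plus; apply continuity_2d_pt_mult;
    (apply continuity_2d_pt_id1 || apply continuity_2d_pt_id2).
Qed.

Lemma continuity_2d_pt_radius a b : continuity_2d_pt (fun x y => sqrt (x ^ 2 + y ^ 2)) a b.
Proof.
  apply (continuity_1d_2d_pt_comp sqrt (fun x y => x ^ 2 + y ^ 2)).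
  - apply continuity_pt_filterlim, continuous_sqrt.
  - apply continuity_2d_pt_sq_norm.
Qed.

Lemma locally_2d_preimage (P : R -> Prop) (g : R -> R -> R) a b :
  continuity_2d_pt g a b -> locally (g a b) P -> locally_2d (fun x y => P (g x y)) a b.
Proof.
  intros Hg HP. apply locally_2d_locally.
  apply continuity_2d_pt_filterlim in Hg. exact (Hg _ HP).
Qed.

Lemma open_axis_disc r : open_region (axis_disc r).
Proof.
  intros a b Hab.
  apply (locally_2d_preimage (fun x => Rbar_lt x r)); [apply continuity_2d_pt_radius |].
  now apply open_Rbar_lt.
Qed.

Lemma locally_axis_disc_l r a b : axis_disc r a b -> locally a (fun s => axis_disc r s b).
Proof. intros H; apply (locally_2d_1d_const_y (axis_disc r)), open_axis_disc, H. Qed.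

Lemma locally_axis_disc_r r a b : axis_disc r a b -> locally b (fun t => axis_disc r a t).
Proof. intros H; apply (locally_2d_1d_const_x (axis_disc r)), open_axis_disc, H. Qed.

Lemma axis_disc_sym r a b : axis_disc r a b -> axis_disc r b a.
Proof. unfold axis_disc. now rewrite Rplus_comm. Qed.

Lemma is_derive_value (g : R -> R) (x l l' : R) : is_derive g x l -> l = l' -> is_derive g x l'.
Proof. now intros H <-. Qed.

Lemma is_derive_comp_sq (F : R -> R) (c a l : R) :
  is_derive F (a ^ 2 + c) l -> is_derive (fun s => F (s ^ 2 + c)) a (2 * a * l).
Proof.
  intros H. apply (is_derive_comp F (fun s => s ^ 2 + c)); [exact H |].
  auto_derive; [easy | ring].
Qed.

Lemma ex_diff_n_const n c a b : ex_diff_n (fun _ _ => c) n a b.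
Proof.
  revert c a b; induction n as [| n IH]; intros c a b; simpl; repeat split;
    try apply continuity_2d_pt_const; try apply ex_derive_const;
    (eapply ex_diff_n_ext_loc; [| apply (IH 0)]; apply locally_2d_forall;
     intros; now rewrite Derive_const).
Qed.

Lemma ex_diff_n_coord_l n a b : ex_diff_n (fun s _ => s) n a b.
Proof.
  destruct n as [| n]; simpl; repeat split;
    try apply continuity_2d_pt_id1; try apply ex_derive_const; try apply ex_derive_id.
  - eapply ex_diff_n_ext_loc; [| apply (ex_diff_n_const n 1)]. apply locally_2d_forall.
    intros; now rewrite Derive_id.
  - eapply ex_diff_n_ext_loc; [| apply (ex_diff_n_const n 0)]. apply locally_2d_forall.
    intros; now rewrite Derive_const.
Qed.

Lemma ex_diff_n_coord_r n a b : ex_diff_n (fun _ t => t) n a b.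
Proof.
  destruct n as [| n]; simpl; repeat split;
    try apply continuity_2d_pt_id2; try apply ex_derive_const; try apply ex_derive_id.
  - eapply ex_diff_n_ext_loc; [| apply (ex_diff_n_const n 0)]. apply locally_2d_forall.
    intros; now rewrite Derive_const.
  - eapply ex_diff_n_ext_loc; [| apply (ex_diff_n_const n 1)]. apply locally_2d_forall.
    intros; now rewrite Derive_id.
Qed.

Lemma continuity_2d_pt_comp_sq_norm (F : R -> R) a b :
  continuous F (a ^ 2 + b ^ 2) -> continuity_2d_pt (fun x y => F (x ^ 2 + y ^ 2)) a b.
Proof.
  intros HF. apply (continuity_1d_2d_pt_comp F (fun x y => x ^ 2 + y ^ 2)).
  - now apply continuity_pt_filterlim.
  - apply continuity_2d_pt_sq_norm.
Qed.

Lemma continuity_2d_pt_ext_disc r (g h : R -> R -> R) a b :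
  (forall x y, axis_disc r x y -> g x y = h x y) -> axis_disc r a b ->
  continuity_2d_pt g a b -> continuity_2d_pt h a b.
Proof.
  intros E H. apply continuity_2d_pt_ext_loc.
  destruct (open_axis_disc r a b H) as [d Hd]. exists d; intros; apply E; now apply Hd.
Qed.

(** * Derivatives and curvatures of a rotational graph whose profile is a function of x^2 *)

Section Radial.
(** Here [q] stands for u' (x) / x as a function of s = x^2; the factor 1/2 in [dPhi] is the chain
    rule for x^2. Everything is differentiated in s, where x = 0 is an ordinary point. *)
Variables (r : Rbar) (u Phi q q1 : R -> R).
Hypothesis uPhi : forall x, 0 <= x -> Rbar_lt x r -> u x = Phi (x ^ 2).
Hypothesis dPhi : forall x, 0 <= x -> Rbar_lt x r -> is_derive Phi (x ^ 2) (q (x ^ 2) / 2).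
Hypothesis dq : forall x, 0 <= x -> Rbar_lt x r -> is_derive q (x ^ 2) (q1 (x ^ 2)).
Hypothesis cq1 : forall x, 0 <= x -> Rbar_lt x r -> continuous q1 (x ^ 2).

Let f a b := u (sqrt (a ^ 2 + b ^ 2)).

(** Each a^2 + b^2 on the disc is the square of a radius below r, so the one-variable hypotheses
    become facts on the disc. *)
Lemma radial_transfer (P : R -> Prop) :
  (forall x, 0 <= x -> Rbar_lt x r -> P (x ^ 2)) ->
  forall a b, axis_disc r a b -> P (a ^ 2 + b ^ 2).
Proof.
  intros HP a b H. rewrite <- (pow2_sqrt (a ^ 2 + b ^ 2)) by nra.
  apply HP; [apply sqrt_pos | exact H].
Qed.

Lemma radial_value a b : axis_disc r a b -> f a b = Phi (a ^ 2 + b ^ 2).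
Proof.
  intros H. unfold f. rewrite uPhi; [| apply sqrt_pos | exact H].
  rewrite pow2_sqrt; [easy | nra].
Qed.

Lemma radial_sym a b : f a b = f b a.
Proof. unfold f. now rewrite Rplus_comm. Qed.

Lemma is_derive_radial_a a b :
  axis_disc r a b -> is_derive (fun s => f s b) a (a * q (a ^ 2 + b ^ 2)).
Proof.
  intros H. apply (is_derive_ext_loc (fun s => Phi (s ^ 2 + b ^ 2))).
  { generalize (locally_axis_disc_l r a b H). apply filter_imp.
    intros s Hs; symmetry; now apply radial_value. }
  eapply is_derive_value; [apply is_derive_comp_sq, (radial_transfer (fun s => is_derive Phi s (q s / 2)) dPhi _ _ H) |].
  simpl; field.
Qed.

(** Exchanging a and b leaves f and the disc unchanged, which reduces this and the later
    b-derivatives to a-derivatives. *)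
Lemma is_derive_radial_b a b :
  axis_disc r a b -> is_derive (fun t => f a t) b (b * q (a ^ 2 + b ^ 2)).
Proof.
  intros H. apply (is_derive_ext (fun t => f t a)); [intros t; apply radial_sym |].
  rewrite Rplus_comm. now apply is_derive_radial_a, axis_disc_sym.
Qed.

Lemma Derive_radial_a a b :
  axis_disc r a b -> Derive (fun s => f s b) a = a * q (a ^ 2 + b ^ 2).
Proof. intros H; now apply is_derive_unique, is_derive_radial_a. Qed.

Lemma Derive_radial_b a b :
  axis_disc r a b -> Derive (fun t => f a t) b = b * q (a ^ 2 + b ^ 2).
Proof. intros H; now apply is_derive_unique, is_derive_radial_b. Qed.

Lemma is_derive_radial_aa a b : axis_disc r a b ->
  is_derive (fun s => Derive (fun s' => f s' b) s) a
    (q (a ^ 2 + b ^ 2) + 2 * a ^ 2 * q1 (a ^ 2 + b ^ 2)).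
Proof.
  intros H. apply (is_derive_ext_loc (fun s => s * q (s ^ 2 + b ^ 2))).
  { generalize (locally_axis_disc_l r a b H). apply filter_imp.
    intros s Hs; symmetry; now apply Derive_radial_a. }
  eapply is_derive_value.
  - apply (is_derive_mult (fun s : R => s) (fun s => q (s ^ 2 + b ^ 2)));
      [apply is_derive_id | apply is_derive_comp_sq, (radial_transfer (fun s => is_derive q s (q1 s)) dq _ _ H) | apply Rmult_comm].
  - unfold plus, mult, one; simpl; ring.
Qed.

Lemma is_derive_radial_ab a b : axis_disc r a b ->
  is_derive (fun s => Derive (fun t => f s t) b) a (2 * a * b * q1 (a ^ 2 + b ^ 2)).
Proof.
  intros H. apply (is_derive_ext_loc (fun s => b * q (s ^ 2 + b ^ 2))).
  { generalize (locally_axis_disc_l r a b H). apply filter_imp.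
    intros s Hs; symmetry; now apply Derive_radial_b. }
  eapply is_derive_value.
  - apply is_derive_scal, is_derive_comp_sq, (radial_transfer (fun s => is_derive q s (q1 s)) dq _ _ H).
  - unfold mult; simpl; ring.
Qed.

Lemma is_derive_radial_bb a b : axis_disc r a b ->
  is_derive (fun t => Derive (fun t' => f a t') t) b
    (q (a ^ 2 + b ^ 2) + 2 * b ^ 2 * q1 (a ^ 2 + b ^ 2)).
Proof.
  intros H. rewrite (Rplus_comm (a ^ 2)).
  apply (is_derive_ext (fun t => Derive (fun t' => f t' a) t)).
  { intros t; apply Derive_ext; intros; apply radial_sym. }
  now apply is_derive_radial_aa, axis_disc_sym.
Qed.

Lemma is_derive_radial_ba a b : axis_disc r a b ->
  is_derive (fun t => Derive (fun s => f s t) a) b (2 * a * b * q1 (a ^ 2 + b ^ 2)).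
Proof.
  intros H. rewrite (Rplus_comm (a ^ 2)), (Rmult_assoc 2), (Rmult_comm a), <- (Rmult_assoc 2).
  apply (is_derive_ext (fun t => Derive (fun s => f t s) a)).
  { intros t; apply Derive_ext; intros; apply radial_sym. }
  now apply is_derive_radial_ab, axis_disc_sym.
Qed.

Ltac cont2d :=
  repeat first [assumption | apply continuity_2d_pt_const | apply continuity_2d_pt_id1
    | apply continuity_2d_pt_id2 | apply continuity_2d_pt_mult | apply continuity_2d_pt_plus].

(** All partial derivatives up to order two are polynomials in a, b and in [q], [q1] at a^2 + b^2,
    with no division by the radius; so they stay continuous on the axis. *)
Lemma ex_diff_n_radial a b : axis_disc r a b -> ex_diff_n f 2 a b.
Proof.
  intros H.
  pose proof (radial_transfer (fun s => is_derive Phi s (q s / 2)) dPhi a b H) as HP.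
  pose proof (radial_transfer (fun s => is_derive q s (q1 s)) dq a b H) as Hq.
  pose proof (radial_transfer (fun s => continuous q1 s) cq1 a b H) as Hq1.
  assert (cP : continuity_2d_pt (fun x y => Phi (x ^ 2 + y ^ 2)) a b).
  { apply continuity_2d_pt_comp_sq_norm, (ex_derive_continuous Phi). eexists; exact HP. }
  assert (cq : continuity_2d_pt (fun x y => q (x ^ 2 + y ^ 2)) a b).
  { apply continuity_2d_pt_comp_sq_norm, (ex_derive_continuous q). eexists; exact Hq. }
  assert (cq1' : continuity_2d_pt (fun x y => q1 (x ^ 2 + y ^ 2)) a b).
  { now apply continuity_2d_pt_comp_sq_norm. }
  (* Squares outside [q] and [q1] are written as products because [cont2d] decomposes products and
     not powers. *)
  assert (caa : continuity_2d_pt (fun x y => q (x ^ 2 + y ^ 2) + 2 * (x * x) * q1 (x ^ 2 + y ^ 2)) a b)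
    by cont2d.
  assert (cbb : continuity_2d_pt (fun x y => q (x ^ 2 + y ^ 2) + 2 * (y * y) * q1 (x ^ 2 + y ^ 2)) a b)
    by cont2d.
  assert (cab : continuity_2d_pt (fun x y => 2 * x * y * q1 (x ^ 2 + y ^ 2)) a b)
    by cont2d.
  assert (ca : continuity_2d_pt (fun x y => x * q (x ^ 2 + y ^ 2)) a b) by cont2d.
  assert (cb : continuity_2d_pt (fun x y => y * q (x ^ 2 + y ^ 2)) a b) by cont2d.
  simpl. repeat split.
  - revert cP; apply (continuity_2d_pt_ext_disc r); [| easy]. intros; symmetry; now apply radial_value.
  - eexists; now apply is_derive_radial_a.
  - eexists; now apply is_derive_radial_b.
  - revert ca; apply (continuity_2d_pt_ext_disc r); [| easy]. intros; symmetry; now apply Derive_radial_a.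
  - eexists; now apply is_derive_radial_aa.
  - eexists; now apply is_derive_radial_ba.
  - revert caa; apply (continuity_2d_pt_ext_disc r); [| easy]. intros x y Hxy; symmetry.
    erewrite is_derive_unique; [| now apply is_derive_radial_aa]. ring.
  - revert cab; apply (continuity_2d_pt_ext_disc r); [| easy]. intros x y Hxy; symmetry.
    erewrite is_derive_unique; [| now apply is_derive_radial_ba]. ring.
  - revert cb; apply (continuity_2d_pt_ext_disc r); [| easy]. intros; symmetry; now apply Derive_radial_b.
  - eexists; now apply is_derive_radial_ab.
  - eexists; now apply is_derive_radial_bb.
  - revert cab; apply (continuity_2d_pt_ext_disc r); [| easy]. intros x y Hxy; symmetry.
    erewrite is_derive_unique; [| now apply is_derive_radial_ab]. ring.
  - revert cbb; apply (continuity_2d_pt_ext_disc r); [| easy]. intros x y Hxy; symmetry.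
    erewrite is_derive_unique; [| now apply is_derive_radial_bb]. ring.
Qed.

Lemma immersed_radial : immersed_surface (axis_disc r) (rot_surface u).
Proof.
  split; [apply open_axis_disc |]. intros a b H.
  split; [apply (ex_diff_n_coord_l 2) |].
  split; [apply (ex_diff_n_coord_r 2) |].
  split; [now apply ex_diff_n_radial |].
  change (rot_surface u) with (graph f). rewrite cross_graph. intros E.
  injection E. lra.
Qed.

(** [W] is 1 + u'^2 in the variable s, and the right side of [W1E] is the s-derivative of 1 + s
    q^2. *)
Variables (W W1 : R -> R).
Hypothesis WE : forall x, 0 <= x -> Rbar_lt x r -> W (x ^ 2) = 1 + x ^ 2 * q (x ^ 2) ^ 2.
Hypothesis W1E : forall x, 0 <= x -> Rbar_lt x r ->
  W1 (x ^ 2) = q (x ^ 2) ^ 2 + 2 * x ^ 2 * q (x ^ 2) * q1 (x ^ 2).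

Lemma radial_w a b : axis_disc r a b ->
  1 + Derive (fun s => f s b) a ^ 2 + Derive (fun t => f a t) b ^ 2 = W (a ^ 2 + b ^ 2).
Proof.
  intros H. rewrite (radial_transfer (fun s => W s = 1 + s * q s ^ 2) WE a b H).
  rewrite Derive_radial_a, Derive_radial_b by easy. ring.
Qed.

Lemma gauss_map_radial a b : axis_disc r a b ->
  let s := a ^ 2 + b ^ 2 in
  gauss_map (rot_surface u) a b =
  (- a * (q s / sqrt (W s)), - b * (q s / sqrt (W s)), / sqrt (W s)).
Proof.
  intros H s. change (rot_surface u) with (graph f).
  rewrite gauss_map_graph. unfold s. rewrite radial_w by easy.
  rewrite Derive_radial_a, Derive_radial_b by easy.
  apply triple_eq; unfold Rdiv; ring.
Qed.

Lemma angle_function_radial a b : axis_disc r a b ->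
  angle_function (rot_surface u) a b = / sqrt (W (a ^ 2 + b ^ 2)).
Proof.
  intros H. unfold angle_function. rewrite gauss_map_radial by easy; cbv zeta.
  unfold dot, e3, px, py, pz; cbn [fst snd]; ring.
Qed.

(** In the Hessian determinant (q + 2 a^2 q1) (q + 2 b^2 q1) - (2 a b q1)^2 the quartic terms
    cancel, leaving q^2 + 2 s q q1, which is [W1]. *)
Lemma gauss_curvature_radial a b : axis_disc r a b ->
  gauss_curvature (rot_surface u) a b = W1 (a ^ 2 + b ^ 2) / W (a ^ 2 + b ^ 2) ^ 2.
Proof.
  intros H. change (rot_surface u) with (graph f).
  rewrite gauss_curvature_graph, radial_w by easy.
  rewrite (radial_transfer (fun s => W1 s = q s ^ 2 + 2 * s * q s * q1 s) W1E a b H).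
  erewrite (is_derive_unique (fun s => Derive _ _)); [| now apply is_derive_radial_aa].
  erewrite (is_derive_unique (fun t => Derive (fun t' => f a t') t)); [| now apply is_derive_radial_bb].
  erewrite (is_derive_unique (fun s => Derive (fun t => f s t) b)); [| now apply is_derive_radial_ab].
  f_equal. ring.
Qed.

(** The principal curvature along the parallels is q / sqrt W. The other one is the Gauss curvature
    divided by it, and the formula is half their sum. *)
Lemma mean_curvature_radial a b : axis_disc r a b ->
  let s := a ^ 2 + b ^ 2 in
  0 < q s ->
  mean_curvature (rot_surface u) a b =
  (q s / sqrt (W s)) / 2 + (W1 s / W s ^ 2) / (2 * (q s / sqrt (W s))).
Proof.
  intros H s Hq. change (rot_surface u) with (graph f).
  rewrite mean_curvature_graph, radial_w by easy.
  pose proof (radial_transfer (fun s => W1 s = q s ^ 2 + 2 * s * q s * q1 s) W1E a b H) as E1.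
  pose proof (radial_transfer (fun s => W s = 1 + s * q s ^ 2) WE a b H) as E.
  erewrite (is_derive_unique (fun s => Derive _ _)); [| now apply is_derive_radial_aa].
  erewrite (is_derive_unique (fun t => Derive (fun t' => f a t') t)); [| now apply is_derive_radial_bb].
  erewrite (is_derive_unique (fun s => Derive (fun t => f s t) b)); [| now apply is_derive_radial_ab].
  rewrite Derive_radial_a, Derive_radial_b by easy.
  fold s in E, E1 |- *.
  assert (HW : 0 < W s) by (rewrite E; unfold s; nra).
  pose proof (sqrt_lt_R0 _ HW) as HS.
  assert (HS2 : W s = sqrt (W s) ^ 2) by (symmetry; apply pow2_sqrt; lra).
  match goal with |- ?N / _ = _ => replace N with ((q s ^ 2 * W s + W1 s) / q s) end.
  - set (S := sqrt (W s)) in *. rewrite HS2. field. lra.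
  - rewrite E, E1. unfold s in *. field. lra.
Qed.

End Radial.

(** * The explicit solution *)

(** The existence interval in the variable s. It also contains negative s near 0, so two-sided
    derivatives at s = 0 are available. *)
Definition dom (k s : R) := 0 < 1 + k * s.

Lemma dom_0 k : dom k 0.
Proof. unfold dom; lra. Qed.

Lemma dom_segment k s t : 0 <= t <= 1 -> dom k s -> dom k (t * s).
Proof.
  unfold dom; intros Ht Hs.
  replace (1 + k * (t * s)) with ((1 - t) + t * (1 + k * s)) by ring.
  destruct (Req_dec t 0) as [-> |]; [lra |].
  assert (0 < t * (1 + k * s)) by (apply Rmult_lt_0_compat; lra). lra.
Qed.

Lemma dom_between k s z : dom k s -> Rmin 0 s <= z <= Rmax 0 s -> dom k z.
Proof.
  unfold dom, Rmin, Rmax; intros Hs. destruct (Rle_dec 0 s); intros Hz; destruct (Rle_dec 0 k); nra.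
Qed.

Lemma locally_dom k s : dom k s -> locally s (dom k).
Proof.
  intros Hs. unfold dom.
  apply (open_comp (fun s => 1 + k * s) (fun y => 0 < y)); [| apply open_gt | exact Hs].
  intros x _. apply (ex_derive_continuous (fun s => 1 + k * s)). auto_derive; easy.
Qed.

Lemma continuity_2d_pt_dom (F : R -> R) k s t n :
  (forall y, dom k y -> continuous F y) -> dom k (t * s) ->
  continuity_2d_pt (fun u v => v ^ n * F (v * u)) s t.
Proof.
  intros CF H. apply continuity_2d_pt_mult.
  - apply (continuity_1d_2d_pt_comp (fun v => v ^ n) (fun _ v => v)).
    + apply derivable_continuous_pt, derivable_pt_pow.
    + apply continuity_2d_pt_id2.
  - apply (continuity_1d_2d_pt_comp F (fun u v => v * u)).
    + apply continuity_pt_filterlim. now apply CF.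
    + apply continuity_2d_pt_mult; [apply continuity_2d_pt_id2 | apply continuity_2d_pt_id1].
Qed.

(** A family closed under differentiation: d/ds brings down one factor t. For F = W' and n = 0 it is
    Hadamard's form of the difference quotient (W s - W 0) / s. *)
Definition moment (n : nat) (F : R -> R) (s : R) := RInt (fun t => t ^ n * F (t * s)) 0 1.

Lemma continuous_moment_integrand n F k s t :
  (forall y, dom k y -> continuous F y) -> dom k s -> 0 <= t <= 1 ->
  continuous (fun t => t ^ n * F (t * s)) t.
Proof.
  intros CF Hs Ht.
  assert (C : continuity_2d_pt (fun u v => v ^ n * F (v * u)) s t)
    by (apply (continuity_2d_pt_dom F k); [easy | now apply dom_segment]).
  intros P HP.
  destruct HP as [e He]. destruct (C e) as [d Hd]. exists d. intros y Hy.
  apply He. apply (Hd s y); [| exact Hy].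
  replace (s - s) with 0 by ring. rewrite Rabs_R0. apply cond_pos.
Qed.

(** Differentiation under the integral sign. It is legitimate because [dom k] contains the segment
    from 0 to each of its points and is open, so the integrand is controlled for all parameters near
    s. *)
Lemma is_derive_moment n F F1 k s :
  (forall y, dom k y -> is_derive F y (F1 y)) -> (forall y, dom k y -> continuous F1 y) ->
  dom k s -> is_derive (moment n F) s (moment (S n) F1 s).
Proof.
  intros DF CF1 Hs.
  assert (CF : forall y, dom k y -> continuous F y)
    by (intros y Hy; apply (ex_derive_continuous F); eexists; now apply DF).
  assert (D : forall u v, dom k (v * u) ->
    is_derive (fun z => v ^ n * F (v * z)) u (v ^ (S n) * F1 (v * u))).
  { intros u v H. eapply is_derive_value.
    - apply is_derive_scal, (is_derive_comp F (fun z => v * z)); [now apply DF |].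
      auto_derive; [easy | reflexivity].
    - unfold scal; simpl; unfold mult; simpl; ring. }
  assert (I : forall t, Rmin 0 1 <= t <= Rmax 0 1 -> 0 <= t <= 1)
    by (rewrite Rmin_left, Rmax_right by lra; easy).
  unfold moment. eapply is_derive_value.
  - apply (is_derive_RInt_param (fun s t => t ^ n * F (t * s))).
    + generalize (locally_dom k s Hs). apply filter_imp. intros u Hu t Ht.
      eexists. now apply D, dom_segment; [apply I |].
    + intros t Ht. apply I in Ht.
      apply continuity_2d_pt_ext_loc with (f := fun u v => v ^ (S n) * F1 (v * u)).
      * apply (locally_2d_impl (fun u v => dom k (v * u))).
        -- apply locally_2d_forall. intros u v H. symmetry. now apply is_derive_unique, D.
        -- apply (locally_2d_preimage (dom k) (fun u v => v * u)).
           ++ apply continuity_2d_pt_mult; [apply continuity_2d_pt_id2 | apply continuity_2d_pt_id1].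
           ++ now apply locally_dom, dom_segment.
      * apply (continuity_2d_pt_dom F1 k); [easy | now apply dom_segment].
    + generalize (locally_dom k s Hs). apply filter_imp. intros u Hu.
      apply (ex_RInt_continuous (fun t => t ^ n * F (t * u))). intros t Ht.
      apply (continuous_moment_integrand n F k); auto.
  - apply RInt_ext. intros t Ht. apply is_derive_unique, D, dom_segment; [apply I; lra | easy].
Qed.

(* With [k = (alpha - 2) / 2], the solution has [1 + u'(x) ^ 2 = W k (x ^ 2)].  Both branches
   satisfy [lnW' = 1 / (1 + k s)], so only this definition distinguishes [alpha = 2]. *)
Definition lnW (k s : R) := if Req_EM_T k 0 then s else ln (1 + k * s) / k.
Definition W (k s : R) := exp (lnW k s).
(** [W1], [W2], [W3] are the successive s-derivatives of [W]. The third gives the continuity of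
    [Wquot1], obtained by differentiating it once more. *)
Definition W1 (k s : R) := W k s / (1 + k * s).
Definition W2 (k s : R) := W k s * (1 - k) / (1 + k * s) ^ 2.
Definition W3 (k s : R) := W k s * (1 - k) * (1 - 2 * k) / (1 + k * s) ^ 3.

Lemma lnW_0 k : lnW k 0 = 0.
Proof.
  unfold lnW. destruct (Req_EM_T k 0); [easy |]. rewrite Rmult_0_r, Rplus_0_r, ln_1. field; easy.
Qed.

Lemma W_0 k : W k 0 = 1.
Proof. unfold W. now rewrite lnW_0, exp_0. Qed.

(** This identifies 1 + k s with W^k in both branches of [lnW], so the curvature equation is
    verified without separating k = 0. *)
Lemma exp_k_lnW k s : dom k s -> exp (k * lnW k s) = 1 + k * s.
Proof.
  intros H. unfold lnW. destruct (Req_EM_T k 0) as [-> | Hk].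
  - rewrite !Rmult_0_l, exp_0. ring.
  - replace (k * (ln (1 + k * s) / k)) with (ln (1 + k * s)) by (field; easy). now apply exp_ln.
Qed.

Lemma is_derive_lnW k s : dom k s -> is_derive (lnW k) s (/ (1 + k * s)).
Proof.
  unfold dom. intros H. unfold lnW. destruct (Req_EM_T k 0) as [-> | Hk].
  - eapply is_derive_value; [apply (is_derive_id (K := R_AbsRing)) |].
    unfold one; simpl. field.
  - auto_derive; [easy |]. field. lra.
Qed.

Lemma W_pos k s : 0 < W k s.
Proof. apply exp_pos. Qed.

Lemma is_derive_W k s : dom k s -> is_derive (W k) s (W1 k s).
Proof.
  intros H. unfold W. eapply is_derive_value.
  - apply (is_derive_comp exp (lnW k)); [apply is_derive_exp | now apply is_derive_lnW].
  - unfold W1, W, scal; simpl; unfold mult; simpl. unfold Rdiv; ring.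
Qed.

Lemma is_derive_W1 k s : dom k s -> is_derive (W1 k) s (W2 k s).
Proof.
  intros H. unfold W1 at 1. eapply is_derive_value.
  - apply (is_derive_div (W k) (fun s => 1 + k * s)); [now apply is_derive_W | | unfold dom in H; lra].
    auto_derive; [easy | reflexivity].
  - unfold W2, W1. unfold dom in H. field. lra.
Qed.

Lemma is_derive_W2 k s : dom k s -> is_derive (W2 k) s (W3 k s).
Proof.
  intros H. unfold W2. assert (H' := H); unfold dom in H'. eapply is_derive_value.
  - apply (is_derive_div (fun s => W k s * (1 - k)) (fun s => (1 + k * s) ^ 2)); [| | nra].
    + apply (is_derive_ext (fun s => (1 - k) * W k s)); [intros; simpl; ring |].
      apply is_derive_scal. now apply is_derive_W.
    + auto_derive; [easy | reflexivity].
  - unfold W3, W1. field. lra.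
Qed.

Lemma continuous_W3 k s : dom k s -> continuous (W3 k) s.
Proof.
  intros H. unfold W3. assert (H' := H); unfold dom in H'.
  apply (ex_derive_continuous (fun s => W k s * (1 - k) * (1 - 2 * k) / (1 + k * s) ^ 3)).
  apply ex_derive_div; [| auto_derive; easy | apply Rgt_not_eq, pow_lt; lra].
  apply ex_derive_mult; [| apply ex_derive_const].
  apply ex_derive_mult; [| apply ex_derive_const].
  eexists; now apply is_derive_W.
Qed.

(* [Wquot k s] is [(W k s - 1) / s], as an integral mean of [W'] so that it is smooth at [s = 0]. *)
Definition Wquot (k s : R) := moment 0 (W1 k) s.
Definition Wquot1 (k s : R) := moment 1 (W2 k) s.

Lemma continuous_of_is_derive (F F1 : R -> R) s : is_derive F s (F1 s) -> continuous F s.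
Proof. intros H. apply (ex_derive_continuous F). now exists (F1 s). Qed.

Lemma is_derive_Wquot k s : dom k s -> is_derive (Wquot k) s (Wquot1 k s).
Proof.
  apply (is_derive_moment 0 (W1 k) (W2 k) k).
  - apply is_derive_W1.
  - intros y Hy. apply continuous_of_is_derive with (W3 k). now apply is_derive_W2.
Qed.

Lemma continuous_Wquot1 k s : dom k s -> continuous (Wquot1 k) s.
Proof.
  intros H. apply continuous_of_is_derive with (F1 := moment 2 (W3 k)).
  apply (is_derive_moment 1 (W2 k) (W3 k) k); [apply is_derive_W2 | apply continuous_W3 | exact H].
Qed.

Lemma continuous_W1 k s : dom k s -> continuous (W1 k) s.
Proof. intros H. eapply continuous_of_is_derive. now apply is_derive_W1. Qed.

(** The fundamental theorem of calculus for t -> W (t s) on [0, 1], with W 0 = 1. *)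
Lemma W_eq_Wquot k s : dom k s -> W k s = 1 + s * Wquot k s.
Proof.
  intros H.
  assert (I : is_RInt (fun t => s * W1 k (t * s)) 0 1 (W k s - 1)).
  { replace (W k s - 1) with (minus (W k (1 * s)) (W k (0 * s)))
      by (rewrite Rmult_1_l, Rmult_0_l, W_0; reflexivity).
    apply (is_RInt_derive (fun t => W k (t * s))); rewrite Rmin_left, Rmax_right by lra; intros t Ht.
    - eapply is_derive_value.
      + apply (is_derive_comp (W k) (fun t => t * s)); [now apply is_derive_W, dom_segment |].
        auto_derive; [easy | reflexivity].
      + unfold scal; simpl; unfold mult; simpl; ring.
    - apply (continuous_scal_r s (fun t => W1 k (t * s))).
      apply (continuous_ext (fun t => t ^ 0 * W1 k (t * s))); [intros; simpl; apply Rmult_1_l |].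
      now apply (continuous_moment_integrand 0 (W1 k) k); [apply continuous_W1 | |]. }
  apply (is_RInt_unique (V := R_CompleteNormedModule)) in I.
  enough (E : RInt (fun t => s * W1 k (t * s)) 0 1 = s * Wquot k s) by lra.
  unfold Wquot, moment. rewrite <- (RInt_scal (V := R_CompleteNormedModule)).
  - apply RInt_ext. intros t _. unfold scal; simpl; unfold mult; simpl; ring.
  - apply (ex_RInt_continuous (fun t => t ^ 0 * W1 k (t * s))).
    rewrite Rmin_left, Rmax_right by lra. intros t Ht.
    now apply (continuous_moment_integrand 0 (W1 k) k); [apply continuous_W1 | |].
Qed.

(** An average of the positive function [W1]. Positivity holds at s = 0 too, which is what makes the
    square root differentiable on the axis. *)
Lemma Wquot_pos k s : dom k s -> 0 < Wquot k s.
Proof.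
  intros H. apply RInt_gt_0; [lra | |]; intros t Ht.
  - simpl. rewrite Rmult_1_l. apply Rdiv_lt_0_compat; [apply W_pos |].
    apply dom_segment; [lra | easy].
  - now apply (continuous_moment_integrand 0 (W1 k) k); [apply continuous_W1 | |].
Qed.

(* The solution is [u x = Phi k (x ^ 2)], with [u' x = x * slope k (x ^ 2)]. *)
Definition slope (k s : R) := sqrt (Wquot k s).
Definition slope1 (k s : R) := Wquot1 k s / (2 * sqrt (Wquot k s)).
Definition Phi (k s : R) := RInt (fun t => slope k t / 2) 0 s.

Lemma slope_pos k s : dom k s -> 0 < slope k s.
Proof. intros H. now apply sqrt_lt_R0, Wquot_pos. Qed.

Lemma is_derive_slope k s : dom k s -> is_derive (slope k) s (slope1 k s).
Proof. intros H. apply is_derive_sqrt; [now apply is_derive_Wquot | now apply Wquot_pos]. Qed.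

Lemma continuous_slope k s : dom k s -> continuous (slope k) s.
Proof. intros H. eapply continuous_of_is_derive. now apply is_derive_slope. Qed.

Lemma continuous_slope1 k s : dom k s -> continuous (slope1 k) s.
Proof.
  intros H. apply (continuous_mult (Wquot1 k) (fun s => / (2 * slope k s))); [now apply continuous_Wquot1 |].
  apply (ex_derive_continuous (fun s => / (2 * slope k s))).
  apply ex_derive_inv; [| pose proof (slope_pos k s H); lra].
  apply ex_derive_scal. eexists; now apply is_derive_slope.
Qed.

Lemma is_derive_Phi k s : dom k s -> is_derive (Phi k) s (slope k s / 2).
Proof.
  intros H.
  assert (C : forall s, dom k s -> continuous (fun t => slope k t / 2) s).
  { intros x Hx. apply (continuous_mult (slope k) (fun _ => / 2)); [now apply continuous_slope |].
    apply continuous_const. }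
  apply (is_derive_RInt (fun t => slope k t / 2)  (Phi k) 0 s); [| now apply C].
  generalize (locally_dom k s H). apply filter_imp. intros x Hx.
  apply (RInt_correct (fun t => slope k t / 2)).
  apply (ex_RInt_continuous (fun t => slope k t / 2)). intros z Hz. apply C.
  now apply (dom_between k x).
Qed.

Lemma is_derive_Phi_sq k x : dom k (x ^ 2) ->
  is_derive (fun x => Phi k (x ^ 2)) x (x * slope k (x ^ 2)).
Proof.
  intros H. eapply is_derive_value.
  - apply (is_derive_comp (Phi k) (fun x => x ^ 2)); [now apply is_derive_Phi |].
    auto_derive; [easy | reflexivity].
  - unfold scal; simpl; unfold mult; simpl; field.
Qed.

Lemma Phi_0 k : Phi k 0 = 0.
Proof. apply (RInt_point 0 (fun t => slope k t / 2)). Qed.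

Lemma slope_sq k s : dom k s -> slope k s ^ 2 = Wquot k s.
Proof. intros H. apply pow2_sqrt. left. now apply Wquot_pos. Qed.

Lemma W_eq_slope k s : dom k s -> W k s = 1 + s * slope k s ^ 2.
Proof. intros H. rewrite slope_sq by easy. now apply W_eq_Wquot. Qed.

(** Both sides are the derivative of [W]: the right one comes from [W_eq_Wquot], an identity valid
    near s since [dom k] is open. *)
Lemma W1_eq_slope k s : dom k s -> W1 k s = slope k s ^ 2 + 2 * s * slope k s * slope1 k s.
Proof.
  intros H. pose proof (slope_pos k s H) as Hq.
  assert (E : W1 k s = Wquot k s + s * Wquot1 k s).
  { rewrite <- (is_derive_unique _ _ _ (is_derive_W k s H)).
    apply is_derive_unique.
    apply (is_derive_ext_loc (fun s => 1 + s * Wquot k s)).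
    - generalize (locally_dom k s H). apply filter_imp. intros x Hx; symmetry; now apply W_eq_Wquot.
    - eapply is_derive_value.
      + apply (is_derive_plus (fun _ => 1)); [apply is_derive_const |].
        apply (is_derive_mult (fun s : R => s) (Wquot k));
          [apply is_derive_id | now apply is_derive_Wquot | apply Rmult_comm].
      + unfold plus, mult, one, zero; simpl; ring. }
  rewrite E, slope_sq by easy. unfold slope1. fold (slope k s). field. lra.
Qed.

(** * Domain of the explicit solution and verification of the curvature equation *)

Definition max_radius (k : R) : Rbar :=
  if Rlt_dec k 0 then Finite (sqrt (- / k)) else p_infty.

Lemma lt_max_radius k x : 0 <= x -> Rbar_lt x (max_radius k) <-> dom k (x ^ 2).
Proof.
  intros Hx. unfold max_radius, dom. destruct (Rlt_dec k 0) as [Hk | Hk]; simpl Rbar_lt.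
  - assert (Hi : 0 < - / k) by (apply Ropp_0_gt_lt_contravar, Rinv_lt_0_compat; lra).
    pose proof (sqrt_lt_R0 _ Hi) as Hr.
    assert (E : sqrt (- / k) ^ 2 = - / k) by (apply pow2_sqrt; lra).
    set (rho := sqrt (- / k)) in *.
    assert (Ek : k * rho ^ 2 = -1) by (rewrite E; field; lra).
    split; intros H.
    + assert (x ^ 2 < rho ^ 2) by nra. nra.
    + destruct (Rlt_le_dec x rho); [easy |].
      assert (rho ^ 2 <= x ^ 2) by nra. nra.
  - split; [intros _ | easy]. assert (0 <= k * x ^ 2) by (apply Rmult_le_pos; nra). lra.
Qed.

Lemma max_radius_pos k : Rbar_lt 0 (max_radius k).
Proof. apply lt_max_radius; [lra |]. rewrite pow_i by auto. apply dom_0. Qed.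

Lemma Rpower_inv_sqrt w c : 0 < w -> Rpower (/ sqrt w) (2 * c) = exp (- c * ln w).
Proof.
  intros Hw. unfold Rpower. f_equal.
  rewrite ln_Rinv by now apply sqrt_lt_R0. rewrite <- Rpower_sqrt by easy.
  unfold Rpower. rewrite ln_exp. field.
Qed.

(** The curvature equation in closed form: W' = W / (1 + k s) = W^(1 - k), so W' / W^2 = W^(-(k +
    1)), which is the power 2 (k + 1) of the angle W^(-1/2). *)
Lemma W1_div_W_sq k s : dom k s ->
  W1 k s / W k s ^ 2 = Rpower (/ sqrt (W k s)) (2 * (k + 1)).
Proof.
  intros H. rewrite Rpower_inv_sqrt by apply W_pos.
  unfold W1, W at 3. rewrite ln_exp. rewrite <- (exp_k_lnW k s H).
  replace (- (k + 1) * lnW k s) with (- lnW k s + - (k * lnW k s)) by ring.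
  rewrite exp_plus, !exp_Ropp. fold (W k s). pose proof (W_pos k s).
  pose proof (exp_pos (k * lnW k s)). field. lra.
Qed.

Section Curvature.
Variables (k : R) (r : Rbar) (u : R -> R).
Hypothesis r_dom : forall x, 0 <= x -> Rbar_lt x r -> dom k (x ^ 2).
Hypothesis uPhi : forall x, 0 <= x -> Rbar_lt x r -> u x = Phi k (x ^ 2).

Let dPhi x (Hx : 0 <= x) (Hr : Rbar_lt x r) := is_derive_Phi k _ (r_dom x Hx Hr).
Let dq x (Hx : 0 <= x) (Hr : Rbar_lt x r) := is_derive_slope k _ (r_dom x Hx Hr).
Let cq1 x (Hx : 0 <= x) (Hr : Rbar_lt x r) := continuous_slope1 k _ (r_dom x Hx Hr).
Let WE x (Hx : 0 <= x) (Hr : Rbar_lt x r) := W_eq_slope k _ (r_dom x Hx Hr).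
Let W1E x (Hx : 0 <= x) (Hr : Rbar_lt x r) := W1_eq_slope k _ (r_dom x Hx Hr).

Lemma disc_dom a b : axis_disc r a b -> dom k (a ^ 2 + b ^ 2).
Proof. now apply (radial_transfer r (dom k)). Qed.

Lemma gauss_map_Phi a b : axis_disc r a b ->
  let s := a ^ 2 + b ^ 2 in
  gauss_map (rot_surface u) a b =
  (- a * (slope k s / sqrt (W k s)), - b * (slope k s / sqrt (W k s)), / sqrt (W k s)).
Proof. intros H. now apply (gauss_map_radial r u (Phi k) (slope k) uPhi dPhi (W k) WE). Qed.

Lemma angle_function_Phi a b : axis_disc r a b ->
  angle_function (rot_surface u) a b = / sqrt (W k (a ^ 2 + b ^ 2)).
Proof. intros H. now apply (angle_function_radial r u (Phi k) (slope k) uPhi dPhi (W k) WE). Qed.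

Lemma gauss_curvature_Phi a b : axis_disc r a b ->
  gauss_curvature (rot_surface u) a b =
  Rpower (/ sqrt (W k (a ^ 2 + b ^ 2))) (2 * (k + 1)).
Proof.
  intros H. rewrite <- W1_div_W_sq by now apply disc_dom.
  now apply (gauss_curvature_radial r u (Phi k) (slope k) (slope1 k) uPhi dPhi dq (W k) (W1 k) WE W1E).
Qed.

Lemma mean_curvature_Phi a b : axis_disc r a b ->
  let s := a ^ 2 + b ^ 2 in
  mean_curvature (rot_surface u) a b =
  (slope k s / sqrt (W k s)) / 2
  + Rpower (/ sqrt (W k s)) (2 * (k + 1)) / (2 * (slope k s / sqrt (W k s))).
Proof.
  intros H s. rewrite <- W1_div_W_sq by now apply disc_dom.
  apply (mean_curvature_radial r u (Phi k) (slope k) (slope1 k) uPhi dPhi dq (W k) (W1 k) WE W1E); [easy |].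
  now apply slope_pos, disc_dom.
Qed.

Lemma rotational_K_graph_Phi :
  Rbar_lt 0 r -> rotational_K_graph (fun y => Rpower y (2 * (k + 1))) r u.
Proof.
  intros r_pos.
  assert (u0 : u 0 = 0) by (rewrite uPhi by (lra || easy); rewrite pow_i by auto; apply Phi_0).
  split; [easy |]. split; [| split; [| split; [| split]]].
  - split; [exact (immersed_radial r u (Phi k) (slope k) (slope1 k) uPhi dPhi dq cq1) |].
    intros a b H. rewrite gauss_curvature_Phi, angle_function_Phi by easy. reflexivity.
  - intros a b H. rewrite angle_function_Phi by easy.
    apply Rinv_0_lt_compat, sqrt_lt_R0, W_pos.
  - exact u0.
  - rewrite u0. pose proof (is_derive_Phi_sq k 0 (r_dom 0 (Rle_refl 0) r_pos)) as D.
    rewrite Rmult_0_l in D. apply is_derive_Reals in D.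
    intros P [e He]. destruct (D e (cond_pos e)) as [d Hd].
    assert (N : locally 0 (fun x => Rbar_lt x r)) by now apply open_Rbar_lt.
    destruct N as [d' Hd'].
    (* [d] makes the difference quotient of Phi (x^2) at 0 small, and [d'] keeps y below r, where u
       agrees with Phi (x^2). *)
    exists (mkposreal _ (Rmin_stable_in_posreal d d')). intros y Hy y0.
    unfold ball in Hy; simpl in Hy; unfold AbsRing_ball, abs, minus, plus, opp in Hy; simpl in Hy.
    apply He. unfold ball; simpl; unfold AbsRing_ball, abs, minus, plus, opp; simpl.
    assert (Hy1 : Rabs (y + - 0) < d) by (eapply Rlt_le_trans; [exact Hy | apply Rmin_l]).
    assert (Hy2 : Rabs (y + - 0) < d') by (eapply Rlt_le_trans; [exact Hy | apply Rmin_r]).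
    rewrite uPhi; [| lra | now apply Hd'].
    specialize (Hd y). rewrite Rplus_0_l, (pow_i 2), Phi_0 in Hd by auto.
    apply Hd; [lra |]. now replace y with (y + - 0) by ring.
  - intros x Hx Hr. rewrite uPhi by easy.
    replace (Phi k (x ^ 2)) with (RInt (fun t => slope k t / 2) 0 (x ^ 2)) by easy.
    assert (B : forall z, 0 <= z <= x ^ 2 -> dom k z).
    { intros z Hz. apply (dom_between k (x ^ 2)); [now apply r_dom |].
      rewrite Rmin_left, Rmax_right by nra. easy. }
    apply RInt_ge_0; [nra | | intros z Hz; left; apply Rdiv_lt_0_compat; [apply slope_pos, B |]; lra].
    apply (ex_RInt_continuous (fun t => slope k t / 2)). rewrite Rmin_left, Rmax_right by nra.
    intros z Hz. apply (continuous_mult (slope k) (fun _ => / 2)); [now apply continuous_slope, B |].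
    apply continuous_const.
Qed.

End Curvature.

(** * Uniqueness of the profile *)

Lemma radius_on_axis x : 0 <= x -> sqrt (x ^ 2 + 0 ^ 2) = x.
Proof. intros Hx. replace (x ^ 2 + 0 ^ 2) with (x * x) by ring. now apply sqrt_square. Qed.

Lemma axis_disc_on_axis r x : 0 <= x -> Rbar_lt x r -> axis_disc r x 0.
Proof. intros Hx Hr. unfold axis_disc. now rewrite radius_on_axis. Qed.

Section Profile.
Variables (k : R) (r : Rbar) (u : R -> R).
Hypothesis Ku : rotational_K_graph (fun y => Rpower y (2 * (k + 1))) r u.

Let f a b := u (sqrt (a ^ 2 + b ^ 2)).
(** Restricting the rotated graph to the first axis extends u evenly to negative arguments, since
    sqrt (s^2) = |s|. Two-sided derivatives at 0 then exist by the regularity of the surface. *)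
Let phi s := f s 0.
Let D := Derive phi.

Lemma profile_pos x : 0 <= x -> phi x = u x.
Proof. intros Hx. unfold phi, f. now rewrite radius_on_axis. Qed.

Lemma profile_radial x t : f x t = phi (sqrt (x ^ 2 + t ^ 2)).
Proof. symmetry. apply profile_pos, sqrt_pos. Qed.

Lemma ex_derive_profile x : 0 <= x -> Rbar_lt x r -> ex_derive phi x.
Proof.
  intros Hx Hr. destruct Ku as (_ & ((_ & I) & _) & _).
  destruct (I x 0 (axis_disc_on_axis r x Hx Hr)) as (_ & _ & (_ & E & _) & _). exact E.
Qed.

Lemma ex_derive_profile_derive x : 0 <= x -> Rbar_lt x r -> ex_derive D x.
Proof.
  intros Hx Hr. destruct Ku as (_ & ((_ & I) & _) & _).
  destruct (I x 0 (axis_disc_on_axis r x Hx Hr)) as (_ & _ & (_ & _ & _ & (_ & E & _) & _) & _).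
  exact E.
Qed.

(** [phi] is even and differentiable at 0, so its derivative there equals its own opposite. *)
Lemma profile_derive_0 : D 0 = 0.
Proof.
  pose proof (Derive_correct _ _ (ex_derive_profile 0 (Rle_refl 0) (proj1 Ku))) as H. fold D in H.
  assert (H' : is_derive phi 0 (- D 0)).
  { apply (is_derive_ext (fun s => phi (- s))).
    - intros t. unfold phi, f. do 2 f_equal. simpl; ring.
    - eapply is_derive_value.
      + apply (is_derive_comp phi Ropp); [rewrite Ropp_0; exact H |].
        auto_derive; [easy | reflexivity].
      + unfold scal; simpl; unfold mult; simpl; ring. }
  apply is_derive_unique in H'. fold D in H'. lra.
Qed.

Lemma profile_db x t : 0 < x -> axis_disc r x t ->
  Derive (fun t => f x t) t = t * (D (sqrt (x ^ 2 + t ^ 2)) / sqrt (x ^ 2 + t ^ 2)).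
Proof.
  intros Hx H. apply is_derive_unique.
  apply (is_derive_ext (fun t => phi (sqrt (x ^ 2 + t ^ 2)))); [intros; now rewrite profile_radial |].
  assert (0 < x ^ 2 + t ^ 2) by nra.
  eapply is_derive_value.
  - apply (is_derive_comp phi (fun t => sqrt (x ^ 2 + t ^ 2))).
    + apply Derive_correct, ex_derive_profile; [apply sqrt_pos | exact H].
    + apply (is_derive_sqrt (fun t => x ^ 2 + t ^ 2) t (2 * t)); [| easy].
      auto_derive; [easy | ring].
  - unfold scal; simpl; unfold mult; simpl. fold D. simpl in *. field.
    apply Rgt_not_eq, sqrt_lt_R0; lra.
Qed.

Lemma locally_pos_lt x : 0 < x -> Rbar_lt x r -> locally x (fun y => 0 < y /\ Rbar_lt y r).
Proof. intros Hx Hr. apply filter_and; [now apply open_gt | now apply open_Rbar_lt]. Qed.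

(** At (x, 0) the b-derivative vanishes, and it does so at all nearby points of the first axis, so
    the mixed derivative is 0 as well. The Hessian determinant is then u'' times u' / x. *)
Lemma profile_ode x : 0 < x -> Rbar_lt x r ->
  Derive D x * D x / x / (1 + D x ^ 2) ^ 2 = exp (- (k + 1) * ln (1 + D x ^ 2)).
Proof.
  intros Hx Hr. pose proof (axis_disc_on_axis r x (Rlt_le _ _ Hx) Hr) as Hd.
  assert (Hs : sqrt (x ^ 2 + 0 ^ 2) = x) by (apply radius_on_axis; lra).
  assert (Hw : 0 < 1 + D x ^ 2) by nra.
  destruct Ku as (_ & (_ & E) & _). specialize (E x 0 Hd).
  change (rot_surface u) with (graph f) in E.
  rewrite angle_function_graph, gauss_curvature_graph in E.
  assert (Eb : Derive (fun t => f x t) 0 = 0) by (rewrite profile_db by easy; ring).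
  assert (Eab : Derive (fun s => Derive (fun t => f s t) 0) x = 0).
  { transitivity (Derive (fun _ => 0) x); [| apply Derive_const]. apply Derive_ext_loc.
    generalize (locally_pos_lt x Hx Hr). apply filter_imp. intros y [y0 yr].
    rewrite profile_db; [ring | easy | apply axis_disc_on_axis; [lra | easy]]. }
  assert (Ebb : Derive (fun t => Derive (fun t' => f x t') t) 0 = D x / x).
  { apply is_derive_unique.
    apply (is_derive_ext_loc (fun t => t * (D (sqrt (x ^ 2 + t ^ 2)) / sqrt (x ^ 2 + t ^ 2)))).
    - generalize (locally_axis_disc_r r x 0 Hd). apply filter_imp. intros t Ht.
      symmetry. now apply profile_db.
    (* The derivative of t h(t) at t = 0 is h(0), so differentiability of h suffices, without the
       value of its derivative. *)
    - assert (Eh : ex_derive (fun t => D (sqrt (x ^ 2 + t ^ 2)) / sqrt (x ^ 2 + t ^ 2)) 0).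
      { assert (Es : ex_derive (fun t => sqrt (x ^ 2 + t ^ 2)) 0) by (auto_derive; nra).
        apply ex_derive_div; [| exact Es | rewrite Hs; lra].
        apply (ex_derive_comp D (fun t => sqrt (x ^ 2 + t ^ 2))); [| exact Es].
        rewrite Hs. apply ex_derive_profile_derive; [lra | easy]. }
      eapply is_derive_value.
      + apply (is_derive_mult (fun t : R => t)); [apply is_derive_id | apply Derive_correct, Eh | apply Rmult_comm].
      + unfold plus, mult, one; simpl. simpl in Hs. rewrite Hs. unfold Rdiv. ring. }
  rewrite Eb, Eab, Ebb in E. fold (D x) in E.
  change (Derive (fun s => f s 0) x) with (D x) in E.
  change (Derive (fun s => Derive (fun s0 => f s0 0) s) x) with (Derive D x) in E.
  replace (1 + D x ^ 2 + 0 ^ 2) with (1 + D x ^ 2) in E by ring.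
  rewrite Rpower_inv_sqrt in E by easy. rewrite <- E.
  unfold Rdiv. ring.
Qed.

(* [ln (1 + u' ^ 2)], for which the curvature equation reads [m' = 2 x exp (- k m)]. *)
Let m x := ln (1 + D x ^ 2).

(** Multiplying out the division by x gives an equation that survives at x = 0, where both sides
    vanish because u' (0) = 0. *)
Lemma is_derive_ln_w x : 0 <= x -> Rbar_lt x r -> is_derive m x (2 * x * exp (- (k * m x))).
Proof.
  intros Hx Hr. assert (Hw : 0 < 1 + D x ^ 2) by nra.
  pose proof (Derive_correct _ _ (ex_derive_profile_derive x Hx Hr)) as HD.
  unfold m at 1. eapply is_derive_value.
  - apply (is_derive_comp ln (fun x => 1 + D x ^ 2)); [now apply is_derive_ln |].
    apply (is_derive_plus (fun _ => 1)); [apply is_derive_const |].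
    apply (is_derive_pow D 2), HD.
  - unfold scal, plus, zero; simpl; unfold mult; simpl.
    destruct (Req_dec x 0) as [-> | Hx0].
    + rewrite profile_derive_0. field.
    + assert (Hx' : 0 < x) by lra. pose proof (profile_ode x Hx' Hr) as E.
      fold (m x) in E. replace (- (k + 1) * m x) with (- (k * m x) + - m x) in E by ring.
      rewrite exp_plus, (exp_Ropp (m x)) in E. unfold m at 2 in E. rewrite exp_ln in E by easy.
      replace (exp (- (k * m x))) with
        (Derive D x * D x / x / (1 + D x ^ 2) ^ 2 * (1 + D x ^ 2)) by (rewrite E; field; lra).
      field. simpl in *. split; [| lra]. lra.
Qed.

Lemma ln_w_0 : m 0 = 0.
Proof. unfold m. rewrite profile_derive_0, pow_i, Rplus_0_r by auto. apply ln_1. Qed.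

Lemma lt_r_of_le t x : t <= x -> Rbar_lt x r -> Rbar_lt t r.
Proof. intros H. now apply (Rbar_le_lt_trans t x r). Qed.

Lemma exp_k_ln_w x : 0 <= x -> Rbar_lt x r -> exp (k * m x) = 1 + k * x ^ 2.
Proof.
  intros Hx Hr. destruct (Req_dec x 0) as [-> | Hx0].
  { rewrite ln_w_0, Rmult_0_r, exp_0. ring. }
  assert (E : forall t, 0 <= t <= x -> is_derive (fun x => exp (k * m x) - k * x ^ 2) t zero).
  { intros t Ht.
    eapply is_derive_value.
    - apply (is_derive_minus (fun x => exp (k * m x)) (fun x => k * x ^ 2) t).
      + apply (is_derive_comp exp (fun x => k * m x)); [apply is_derive_exp |].
        apply is_derive_scal, is_derive_ln_w; [lra | apply (lt_r_of_le t x); [lra | easy]].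
      + auto_derive; [easy | reflexivity].
    - unfold scal, minus, plus, opp, zero; simpl; unfold mult; simpl.
      rewrite exp_Ropp. field. apply Rgt_not_eq, exp_pos. }
  apply eq_is_derive in E; [| lra].
  simpl in E. rewrite ln_w_0, Rmult_0_r, exp_0 in E. simpl. lra.
Qed.

Lemma profile_dom x : 0 <= x -> Rbar_lt x r -> dom k (x ^ 2).
Proof. intros Hx Hr. unfold dom. rewrite <- exp_k_ln_w by easy. apply exp_pos. Qed.

(** For k = 0 the identity [exp_k_ln_w] says nothing about m. Inserted into the equation for m' it
    gives 2 x / (1 + k x^2) for every k, which is the derivative of [lnW k (x ^ 2)]; both functions
    vanish at 0. *)
Lemma profile_derive_sq x : 0 <= x -> Rbar_lt x r -> 1 + D x ^ 2 = W k (x ^ 2).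
Proof.
  intros Hx Hr. unfold W.
  enough (E : m x = lnW k (x ^ 2)).
  { rewrite <- E. unfold m. rewrite exp_ln; [easy | nra]. }
  destruct (Req_dec x 0) as [-> | Hx0].
  { now rewrite ln_w_0, pow_i, lnW_0 by auto. }
  assert (E : forall t, 0 <= t <= x -> is_derive (fun x => m x - lnW k (x ^ 2)) t zero).
  { intros t Ht.
    assert (Ht' : Rbar_lt t r) by (apply (lt_r_of_le t x); [lra | easy]).
    eapply is_derive_value.
    - apply (is_derive_minus m (fun x => lnW k (x ^ 2)) t).
      + now apply is_derive_ln_w.
      + apply (is_derive_comp (lnW k) (fun x => x ^ 2)); [now apply is_derive_lnW, profile_dom |].
        auto_derive; [easy | reflexivity].
    - unfold scal, minus, plus, opp, zero; simpl; unfold mult; simpl.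
      rewrite exp_Ropp, exp_k_ln_w by easy. simpl. field.
      pose proof (profile_dom t (proj1 Ht) Ht') as Hd. unfold dom in Hd. simpl in Hd. lra. }
  apply eq_is_derive in E; [| lra].
  simpl in E. rewrite Rmult_0_l, lnW_0, ln_w_0 in E. simpl. lra.
Qed.

(* The sign of [u']: it satisfies [sigma ^ 2 = 1], hence is locally constant. *)
Let sigma x := D x / (x * slope k (x ^ 2)).

Lemma slope_sign_sq x : 0 < x -> Rbar_lt x r -> sigma x ^ 2 = 1.
Proof.
  intros Hx Hr. assert (Hd : dom k (x ^ 2)) by (apply profile_dom; [lra | easy]).
  pose proof (slope_pos k _ Hd) as Hq.
  unfold sigma. replace ((D x / (x * slope k (x ^ 2))) ^ 2) with (D x ^ 2 / (x ^ 2 * slope k (x ^ 2) ^ 2)) by (field; lra).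
  assert (E : D x ^ 2 = x ^ 2 * slope k (x ^ 2) ^ 2).
  { pose proof (profile_derive_sq x (Rlt_le _ _ Hx) Hr). pose proof (W_eq_slope k _ Hd). lra. }
  rewrite E. field. lra.
Qed.

Lemma is_derive_slope_sign x : 0 < x -> Rbar_lt x r -> is_derive sigma x 0.
Proof.
  intros Hx Hr. assert (Hd : dom k (x ^ 2)) by (apply profile_dom; [lra | easy]).
  pose proof (slope_pos k _ Hd) as Hq.
  assert (Es : ex_derive sigma x).
  { apply ex_derive_div; [apply ex_derive_profile_derive; [lra | easy] | | apply Rgt_not_eq, Rmult_lt_0_compat; lra].
    apply (ex_derive_mult (fun x => x)); [apply ex_derive_id |].
    apply (ex_derive_comp (slope k) (fun x => x ^ 2)); [eexists; now apply is_derive_slope |].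
    auto_derive; easy. }
  pose proof (Derive_correct _ _ Es) as H.
  assert (H2 : is_derive (fun x => sigma x ^ 2) x 0).
  { apply (is_derive_ext_loc (fun _ => 1)); [| exact (is_derive_const (K := R_AbsRing) (V := R_NormedModule) 1 x)].
    generalize (locally_pos_lt x Hx Hr). apply filter_imp. intros y [y0 yr].
    symmetry. now apply slope_sign_sq. }
  (* Two values of one derivative give 2 sigma sigma' = 0, and sigma^2 = 1 excludes sigma = 0. *)
  pose proof (is_derive_pow sigma 2 x _ H) as H3.
  apply is_derive_unique in H2, H3. pose proof (eq_trans (eq_sym H3) H2) as H4.
  simpl in H4. pose proof (slope_sign_sq x Hx Hr) as H5.
  replace 0 with (Derive sigma x) by nra. exact H.
Qed.

(** A negative sign at x would persist on all of (0, x], making u' negative there; the mean value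
    theorem would then give u x < u 0 = 0, against u >= 0. *)
Lemma slope_sign_pos x : 0 < x -> Rbar_lt x r -> 0 < sigma x.
Proof.
  intros Hx Hr. destruct (Rlt_le_dec 0 (sigma x)) as [| Hs]; [easy | exfalso].
  assert (Hs' : sigma x < 0) by (pose proof (slope_sign_sq x Hx Hr); nra).
  assert (N : forall y, 0 < y <= x -> D y < 0).
  { intros y Hy. assert (yr : Rbar_lt y r) by now apply (lt_r_of_le y x).
    assert (Ey : sigma y = sigma x).
    { destruct (Req_dec y x) as [-> | Hyx]; [easy |].
      apply eq_is_derive; [| lra]. intros t Ht.
      apply is_derive_slope_sign; [lra |]. now apply (lt_r_of_le t x). }
    assert (Hq : 0 < slope k (y ^ 2)) by (apply slope_pos, profile_dom; [lra | easy]).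
    assert (0 < y * slope k (y ^ 2)) by (apply Rmult_lt_0_compat; lra).
    replace (D y) with (sigma y * (y * slope k (y ^ 2))) by (unfold sigma; field; lra).
    rewrite Ey. nra. }
  destruct (MVT_cor2 phi D 0 x Hx) as (c & Ec & Hc).
  { intros c Hc. apply is_derive_Reals, Derive_correct, ex_derive_profile; [easy |].
    now apply (lt_r_of_le c x). }
  destruct Ku as (_ & _ & _ & u0 & _ & upos).
  rewrite !profile_pos, u0 in Ec by lra.
  specialize (upos x (Rlt_le _ _ Hx) Hr). specialize (N c ltac:(lra)). nra.
Qed.

Lemma profile_derive_eq x : 0 <= x -> Rbar_lt x r -> D x = x * slope k (x ^ 2).
Proof.
  intros Hx Hr. destruct (Req_dec x 0) as [-> | Hx0]; [rewrite profile_derive_0; ring |].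
  assert (Hx' : 0 < x) by lra.
  assert (Hq : 0 < slope k (x ^ 2)) by now apply slope_pos, profile_dom.
  assert (E : sigma x = 1) by (pose proof (slope_sign_pos x Hx' Hr); pose proof (slope_sign_sq x Hx' Hr); nra).
  replace (D x) with (sigma x * (x * slope k (x ^ 2))) by (unfold sigma; field; lra).
  rewrite E. ring.
Qed.

Lemma profile_eq_Phi x : 0 <= x -> Rbar_lt x r -> u x = Phi k (x ^ 2).
Proof.
  intros Hx Hr. rewrite <- profile_pos by easy.
  assert (E0 : phi 0 = 0).
  { rewrite profile_pos by lra. apply Ku. }
  destruct (Req_dec x 0) as [-> | Hx0].
  { now rewrite E0, pow_i, Phi_0 by auto. }
  assert (E : forall t, 0 <= t <= x -> is_derive (fun x => phi x - Phi k (x ^ 2)) t zero).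
  { intros t Ht.
    assert (Ht' : Rbar_lt t r) by now apply (lt_r_of_le t x).
    eapply is_derive_value.
    - apply (is_derive_minus phi (fun x => Phi k (x ^ 2)) t).
      + now apply Derive_correct, ex_derive_profile.
      + now apply is_derive_Phi_sq, profile_dom.
    - fold D. rewrite profile_derive_eq by easy. apply Rplus_opp_r. }
  apply eq_is_derive in E; [| lra].
  simpl in E. rewrite Rmult_0_l, Phi_0, E0 in E. simpl. lra.
Qed.

(** If r exceeded a finite maximal radius rho, then rho itself would lie in [0, r) and [profile_dom]
    would apply to it, although 1 + k rho^2 = 0. *)
Lemma radius_le_max : Rbar_le r (max_radius k).
Proof.
  apply Rbar_not_lt_le. intros H.
  destruct (max_radius k) as [rho | |] eqn:E; [| easy |].
  - assert (H0 : Rbar_lt 0 rho) by (rewrite <- E; apply max_radius_pos).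
    simpl in H0. pose proof (profile_dom rho (Rlt_le _ _ H0) H) as Hd.
    apply lt_max_radius in Hd; [| lra]. rewrite E in Hd. simpl in Hd. lra.
  - pose proof (max_radius_pos k) as H0. now rewrite E in H0.
Qed.

End Profile.

(** * Maximality of the explicit solution and its integral formula *)

Lemma maximal_rotational_K_graph_Phi k :
  maximal_rotational_K_graph (fun y => Rpower y (2 * (k + 1))) (max_radius k)
    (fun x => Phi k (x ^ 2)).
Proof.
  split.
  - apply rotational_K_graph_Phi; [| easy | apply max_radius_pos].
    intros x Hx. now apply lt_max_radius.
  - intros r v Hv Hle _. apply Rbar_le_antisym; [| easy].
    now apply (radius_le_max k r v).
Qed.

(** The explicit solution on its full interval extends u, so the maximality of u forces the two
    radii to agree. *)
Lemma maximal_rotational_K_graph_radius k r u :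
  maximal_rotational_K_graph (fun y => Rpower y (2 * (k + 1))) r u -> r = max_radius k.
Proof.
  intros [Ku M]. symmetry.
  apply (M (max_radius k) (fun x => Phi k (x ^ 2))).
  - apply maximal_rotational_K_graph_Phi.
  - now apply (radius_le_max k r u).
  - intros x Hx Hr. symmetry. now apply (profile_eq_Phi k r u).
Qed.

(** The integrand sqrt (w - 1) is u' for the nonnegative branch. It is replaced by t times [slope],
    which is visibly continuous up to t = 0. *)
Lemma is_RInt_Phi k x : 0 <= x -> dom k (x ^ 2) ->
  is_RInt (fun t => sqrt (W k (t ^ 2) - 1)) 0 x (Phi k (x ^ 2)).
Proof.
  intros Hx Hd.
  assert (B : forall t, 0 <= t <= x -> dom k (t ^ 2)).
  { intros t Ht. apply (dom_between k (x ^ 2)); [easy |].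
    rewrite Rmin_left, Rmax_right by nra. nra. }
  apply (is_RInt_ext (fun t => t * slope k (t ^ 2))).
  { rewrite Rmin_left, Rmax_right by lra. intros t Ht.
    rewrite W_eq_slope by (apply B; lra).
    replace (1 + t ^ 2 * slope k (t ^ 2) ^ 2 - 1) with (Rsqr (t * slope k (t ^ 2))) by (unfold Rsqr; ring).
    symmetry; apply sqrt_Rsqr. apply Rmult_le_pos; [lra |]. left; apply slope_pos, B; lra. }
  replace (Phi k (x ^ 2)) with (minus (Phi k (x ^ 2)) (Phi k (0 ^ 2)))
    by (rewrite (pow_i 2), Phi_0 by auto; unfold minus, plus, opp; simpl; ring).
  apply (is_RInt_derive (fun t => Phi k (t ^ 2)));
    rewrite Rmin_left, Rmax_right by lra; intros t Ht.
  - now apply is_derive_Phi_sq, B.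
  - apply (ex_derive_continuous (fun t => t * slope k (t ^ 2))).
    apply (ex_derive_mult (fun x => x)); [apply ex_derive_id |].
    apply (ex_derive_comp (slope k) (fun x => x ^ 2)); [eexists; now apply is_derive_slope, B |].
    auto_derive; easy.
Qed.

(** * Asymptotics *)

(** The mean value theorem for f - c h with c = l - eps/2 and c = l + eps/2 shows that one function
    stays above, the other below, its value at B; the divergence of h absorbs these two values. *)
Lemma lhopital_p_infty (f df h dh : R -> R) (A l : R) :
  (forall x, A < x -> is_derive f x (df x)) ->
  (forall x, A < x -> is_derive h x (dh x)) ->
  (forall x, A < x -> 0 < dh x) ->
  is_lim h p_infty p_infty ->
  is_lim (fun x => df x / dh x) p_infty l ->
  is_lim (fun x => f x / h x) p_infty l.
Proof.
  intros Df Dh dh_pos Lh Lr. apply is_lim_spec. intros eps.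
  apply is_lim_spec in Lr. destruct (Lr (pos_div_2 eps)) as [M HM]. simpl in HM.
  set (B := Rmax A M + 1).
  assert (HB : A < B /\ M < B) by (pose proof (Rmax_l A M); pose proof (Rmax_r A M); unfold B; lra).
  assert (D : forall c x, B < x -> exists z, B < z /\
    f x - c * h x - (f B - c * h B) = (df z - c * dh z) * (x - B)).
  { intros c x Hx.
    destruct (MVT_cor2 (fun x => f x - c * h x) (fun x => df x - c * dh x) B x Hx) as (z & Ez & Hz).
    - intros z Hz. apply is_derive_Reals.
      apply (is_derive_minus f (fun x => c * h x) z (df z) (c * dh z)); [apply Df; lra |].
      apply is_derive_scal, Dh; lra.
    - exists z. split; [easy | exact Ez]. }
  assert (Q : forall z, B < z -> (l - eps / 2) * dh z <= df z <= (l + eps / 2) * dh z).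
  { intros z Hz. specialize (HM z ltac:(lra)). specialize (dh_pos z ltac:(lra)).
    apply Rabs_def2 in HM.
    replace (df z) with (df z / dh z * dh z) by (field; lra).
    split; apply Rmult_le_compat_r; lra. }
  (* [c1] bounds both boundary values at B; once h x exceeds 2 c1 / eps they cost less than eps/2
     times h x, the remaining half of the tolerance. *)
  set (c1 := Rabs (f B - (l - eps / 2) * h B) + Rabs (f B - (l + eps / 2) * h B)).
  apply is_lim_spec in Lh. destruct (Lh (2 * c1 / eps)) as [M' HM'].
  exists (Rmax B M'). intros x Hx.
  assert (Hx1 : B < x) by (pose proof (Rmax_l B M'); lra).
  assert (Hx2 : M' < x) by (pose proof (Rmax_r B M'); lra).
  specialize (HM' x Hx2). pose proof (cond_pos eps) as He.
  assert (Hc1 : 0 <= c1).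
  { unfold c1. pose proof (Rabs_pos (f B - (l - eps / 2) * h B)).
    pose proof (Rabs_pos (f B - (l + eps / 2) * h B)). lra. }
  assert (Hh : c1 < eps / 2 * h x).
  { replace c1 with (eps / 2 * (2 * c1 / eps)) by (field; lra).
    apply Rmult_lt_compat_l; lra. }
  assert (Hh0 : 0 < h x).
  { apply Rle_lt_trans with (2 * c1 / eps); [| easy].
    apply Rmult_le_pos; [lra | left; now apply Rinv_0_lt_compat]. }
  destruct (D (l - eps / 2) x Hx1) as (z1 & Hz1 & E1).
  destruct (D (l + eps / 2) x Hx1) as (z2 & Hz2 & E2).
  pose proof (Q z1 Hz1) as [Q1 _]. pose proof (Q z2 Hz2) as [_ Q2].
  assert (0 <= (df z1 - (l - eps / 2) * dh z1) * (x - B)) by (apply Rmult_le_pos; lra).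
  assert (0 <= ((l + eps / 2) * dh z2 - df z2) * (x - B)) by (apply Rmult_le_pos; lra).
  pose proof (Rle_abs (f B - (l + eps / 2) * h B)).
  pose proof (Rle_abs (- (f B - (l - eps / 2) * h B))). rewrite Rabs_Ropp in *.
  pose proof (Rabs_pos (f B - (l - eps / 2) * h B)).
  pose proof (Rabs_pos (f B - (l + eps / 2) * h B)).
  assert (U : f x < (l + eps) * h x) by (unfold c1 in *; lra).
  assert (V : (l - eps) * h x < f x) by (unfold c1 in *; lra).
  apply Rabs_def1; apply Rmult_lt_reg_r with (h x); try easy; field_simplify; lra.
Qed.

Lemma W_Rpower k s : k <> 0 -> W k s = Rpower (1 + k * s) (1 / k).
Proof.
  intros Hk. unfold W, lnW, Rpower. destruct (Req_EM_T k 0); [easy |]. f_equal. field; easy.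
Qed.

(** The slope sqrt ((1 + k x^2)^(1/k) - 1) is asymptotic to sqrt (k^(1/k)) x^(1/k). Integration adds
    one to the exponent, giving (k + 1) / k = alpha / (alpha - 2), and divides the constant by this
    new exponent. *)
Lemma is_lim_Phi_div k : 0 < k ->
  is_lim (fun x => Phi k (x ^ 2) / Rpower x ((k + 1) / k)) p_infty
    (sqrt (exp (1 / k * ln k)) / ((k + 1) / k)).
Proof.
  intros Hk. set (c := 1 / k).
  assert (Hc : 0 < c) by (apply Rdiv_lt_0_compat; lra).
  replace ((k + 1) / k) with (1 + c) by (unfold c; field; lra).
  assert (Hd : forall x, dom k (x ^ 2)).
  { intros x. unfold dom. assert (0 <= k * x ^ 2) by (apply Rmult_le_pos; nra). lra. }
  apply (lhopital_p_infty _ (fun x => x * slope k (x ^ 2)) _ (fun x => (1 + c) * Rpower x c) 0).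
  - intros x _. now apply is_derive_Phi_sq.
  - intros x Hx. apply is_derive_Reals. replace c with (1 + c - 1) at 2 by ring.
    now apply derivable_pt_lim_power.
  - intros x _. apply Rmult_lt_0_compat; [lra | apply exp_pos].
  - unfold Rpower. apply (is_lim_comp exp (fun x => (1 + c) * ln x) p_infty p_infty p_infty).
    + apply is_lim_exp_p.
    + replace p_infty with (Rbar_mult (1 + c) p_infty) at 2.
      * apply is_lim_scal_l, is_lim_ln_p.
      * simpl. destruct (Rle_dec 0 (1 + c)) as [H | H]; [| lra].
        destruct (Rle_lt_or_eq_dec 0 (1 + c) H); [easy | lra].
    + now exists 0.
  (* With c = 1 / k, the factor x^(2c) is pulled out of (1 + k x^2)^c - 1, leaving (k + x^(-2))^c -
     x^(-2c), which tends to k^c. *)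
  - apply (is_lim_ext_loc (fun x =>
      sqrt (exp (c * ln (k + (/ x) ^ 2)) - exp (- (2 * c) * ln x)) * / (1 + c))).
    + exists 0. intros x Hx.
      assert (Hq : 0 < slope k (x ^ 2)) by now apply slope_pos.
      assert (E : x * slope k (x ^ 2) = sqrt (W k (x ^ 2) - 1)).
      { rewrite W_eq_slope by easy.
        replace (1 + x ^ 2 * slope k (x ^ 2) ^ 2 - 1) with (Rsqr (x * slope k (x ^ 2))) by (unfold Rsqr; ring).
        symmetry. apply sqrt_Rsqr, Rmult_le_pos; lra. }
      rewrite E, W_Rpower by lra. fold c. unfold Rpower.
      assert (Hx2 : 0 < (/ x) ^ 2) by now apply pow_lt, Rinv_0_lt_compat.
      assert (E1 : ln (1 + k * x ^ 2) = ln (k + (/ x) ^ 2) + 2 * ln x).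
      { replace (2 * ln x) with (ln (x ^ 2)) by (rewrite ln_pow by easy; simpl; ring).
        rewrite <- ln_mult by nra. f_equal. field; lra. }
      pose proof (exp_pos (c * ln x)) as He.
      replace (exp (c * ln (1 + k * x ^ 2)) - 1) with
        ((exp (c * ln (k + (/ x) ^ 2)) - exp (- (2 * c) * ln x)) * Rsqr (exp (c * ln x))).
      * rewrite sqrt_mult_alt.
        -- rewrite sqrt_Rsqr by lra. field. lra.
        -- apply (proj1 (Rminus_le_0 _ _)), Rnot_lt_le. intros Hlt. apply exp_lt_inv in Hlt.
           assert (P : ln (k + (/ x) ^ 2) + 2 * ln x >= 0).
           { rewrite <- E1. rewrite <- ln_1. apply Rle_ge, ln_le; [lra |].
             assert (0 <= k * x ^ 2) by (apply Rmult_le_pos; nra). lra. }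
           nra.
      * unfold Rsqr. rewrite <- exp_plus, Rmult_minus_distr_r, <- !exp_plus, E1.
        rewrite <- exp_0. f_equal; [f_equal; ring | f_equal; f_equal; ring].
    + apply (is_lim_scal_r _ (/ (1 + c)) p_infty (sqrt (exp (c * ln k)))).
      apply (is_lim_comp_continuous _ sqrt _ (exp (c * ln k))); [| apply continuous_sqrt].
      replace (exp (c * ln k)) with (exp (c * ln k) - 0) by ring.
      apply is_lim_minus'.
      (* In the variable y = 1 / x the limit is continuity at y = 0, where k > 0 keeps the logarithm
         regular. *)
      * replace (exp (c * ln k)) with (exp (c * ln (k + 0 ^ 2))) by (do 3 f_equal; ring).
        apply (is_lim_comp_continuous Rinv (fun y => exp (c * ln (k + y ^ 2))) _ 0).
        -- apply (is_lim_inv (fun x => x) p_infty p_infty); [apply is_lim_id | easy].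
        -- apply (ex_derive_continuous (fun y => exp (c * ln (k + y ^ 2)))). auto_derive. lra.
      * apply (is_lim_comp exp (fun x => - (2 * c) * ln x) p_infty 0 m_infty).
        -- apply is_lim_exp_m.
        -- replace m_infty with (Rbar_mult (- (2 * c)) p_infty).
           ++ apply is_lim_scal_l, is_lim_ln_p.
           ++ simpl. destruct (Rle_dec 0 (- (2 * c))) as [H | H]; [exfalso; lra | easy].
        -- now exists 0.
Qed.

(** * The vertical cylinder and convergence to it *)

Section Cylinder.
Variable rho : R.
Let Y := vertical_cylinder rho.

Lemma Da_cylinder z t : Da Y z t = (0, 0, 1).
Proof.
  unfold Da, Y, vertical_cylinder, px, py, pz; simpl; apply triple_eq;
    [apply Derive_const | apply Derive_const | apply Derive_id].
Qed.

Lemma Db_cylinder z t : Db Y z t = (- rho * sin t, rho * cos t, 0).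
Proof.
  unfold Db, Y, vertical_cylinder, px, py, pz; simpl; apply triple_eq;
    [| | apply Derive_const]; apply is_derive_unique; auto_derive; auto; ring.
Qed.

Lemma Da_Da_cylinder z t : Da (Da Y) z t = (0, 0, 0).
Proof.
  unfold Da at 1; apply triple_eq; (etransitivity;
    [apply Derive_ext; intros; rewrite Da_cylinder; reflexivity | apply Derive_const]).
Qed.

Lemma Da_Db_cylinder z t : Da (Db Y) z t = (0, 0, 0).
Proof.
  unfold Da at 1; apply triple_eq; (etransitivity;
    [apply Derive_ext; intros; rewrite Db_cylinder; reflexivity | apply Derive_const]).
Qed.

Lemma Db_Db_cylinder z t : Db (Db Y) z t = (- rho * cos t, - rho * sin t, 0).
Proof.
  unfold Db at 1; apply triple_eq; (etransitivity;
    [apply Derive_ext; intros; rewrite Db_cylinder; reflexivity |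
     apply is_derive_unique; unfold px, py, pz; simpl; auto_derive; auto; ring]).
Qed.

Hypothesis rho_pos : 0 < rho.

Lemma gauss_map_cylinder z t : gauss_map Y z t = (- cos t, - sin t, 0).
Proof.
  unfold gauss_map. rewrite Da_cylinder, Db_cylinder.
  unfold norm3, scal3, dot, cross, px, py, pz; cbn [fst snd].
  match goal with |- context [sqrt ?e] => replace e with (Rsqr rho) end.
  - rewrite sqrt_Rsqr by lra. apply triple_eq; field; lra.
  - pose proof (sin2_cos2 t) as H. unfold Rsqr in *.
    replace (rho * rho) with (rho * rho * (sin t * sin t + cos t * cos t)) by (rewrite H; ring).
    ring.
Qed.

Lemma gauss_curvature_cylinder z t : gauss_curvature Y z t = 0.
Proof.
  unfold gauss_curvature, sfe, sff, sfg.
  rewrite Da_Da_cylinder, Da_Db_cylinder. unfold dot, px, py, pz; cbn [fst snd].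
  unfold Rdiv. ring.
Qed.

(** Principal curvatures 0 and 1 / rho, the latter positive because the normal points to the
    axis. *)
Lemma mean_curvature_cylinder z t : mean_curvature Y z t = / (2 * rho).
Proof.
  unfold mean_curvature, sfe, sff, sfg, ffE, ffF, ffG.
  rewrite Da_Da_cylinder, Da_Db_cylinder, Db_Db_cylinder, gauss_map_cylinder, Da_cylinder, Db_cylinder.
  unfold dot, px, py, pz; cbn [fst snd].
  pose proof (sin2_cos2 t) as H. unfold Rsqr in H.
  set (c := cos t) in *. set (s := sin t) in *.
  replace (- c * (- rho * c) + - s * (- rho * s) + 0 * 0) with (rho * (s * s + c * c)) by ring.
  replace (- rho * s * (- rho * s) + rho * c * (rho * c) + 0 * 0) with (rho * rho * (s * s + c * c)) by ring.
  rewrite H. field. lra.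
Qed.

End Cylinder.

Lemma filterlim_exp_ln_left k beta : k < 0 -> 0 < beta ->
  filterlim (fun x => exp (beta * ln (1 + k * x ^ 2))) (at_left (sqrt (- / k))) (locally 0).
Proof.
  intros Hk Hb. assert (Hi : 0 < - / k) by (apply Ropp_0_gt_lt_contravar, Rinv_lt_0_compat; lra).
  pose proof (sqrt_lt_R0 _ Hi) as Hr.
  assert (E : sqrt (- / k) ^ 2 = - / k) by (apply pow2_sqrt; lra).
  set (rho := sqrt (- / k)) in *.
  intros P [e He]. unfold filtermap.
  assert (C : continuous (fun x => 1 + k * x ^ 2) rho)
    by (apply (ex_derive_continuous (fun x => 1 + k * x ^ 2)); auto_derive; easy).
  (* For positive base, (1 + k x^2)^beta < e amounts to 1 + k x^2 < e^(1/beta), which holds near rho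
     because 1 + k rho^2 = 0. *)
  assert (N : locally rho (fun x => 1 + k * x ^ 2 < exp (ln e / beta))).
  { apply (C (fun y => y < exp (ln e / beta))). apply open_lt. rewrite E.
    replace (1 + k * - / k) with 0 by (field; lra). apply exp_pos. }
  (* Positivity of x turns x < rho into x^2 < rho^2, so that 1 + k x^2 > 0 and its logarithm is
     meaningful. *)
  assert (N' : locally rho (fun x => 0 < x)) by now apply open_gt.
  generalize (filter_and _ _ N N'). unfold at_left, within. apply filter_imp.
  intros x [H x0] Hx. apply He.
  unfold ball; simpl; unfold AbsRing_ball, abs, minus, plus, opp; simpl.
  rewrite Ropp_0, Rplus_0_r, Rabs_pos_eq by (left; apply exp_pos).
  rewrite <- (exp_ln e) by apply cond_pos. apply exp_increasing.
  assert (0 < 1 + k * x ^ 2).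
  { assert (x ^ 2 < rho ^ 2) by nra.
    assert (k * rho ^ 2 = -1) by (rewrite E; field; lra). nra. }
  apply ln_increasing in H; [| easy]. rewrite ln_exp in H.
  replace (ln e) with (beta * (ln e / beta)) by (field; lra).
  now apply Rmult_lt_compat_l.
Qed.

Lemma filterlim_Rmult_real {F : (R -> Prop) -> Prop} {FF : Filter F} (f h : R -> R) (a b : R) :
  filterlim f F (locally a) -> filterlim h F (locally b) ->
  filterlim (fun x => f x * h x) F (locally (a * b)).
Proof.
  intros Hf Hh. apply (filterlim_comp_2 (G := locally a) (H := locally b)); try easy.
  apply (filterlim_mult a b).
Qed.

Lemma filterlim_Rplus_real {F : (R -> Prop) -> Prop} {FF : Filter F} (f h : R -> R) (a b : R) :
  filterlim f F (locally a) -> filterlim h F (locally b) ->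
  filterlim (fun x => f x + h x) F (locally (a + b)).
Proof.
  intros Hf Hh. apply (filterlim_comp_2 (G := locally a) (H := locally b)); try easy.
  apply (filterlim_plus a b).
Qed.

Lemma filterlim_continuous {F : (R -> Prop) -> Prop} {FF : Filter F} (f h : R -> R) (a : R) :
  filterlim f F (locally a) -> ex_derive h a -> filterlim (fun x => h (f x)) F (locally (h a)).
Proof.
  intros Hf Hh. apply (filterlim_comp _ _ _ f h F (locally a)); [easy |].
  now apply (ex_derive_continuous h).
Qed.

Lemma eventually_near {F : (R -> Prop) -> Prop} {FF : Filter F} (f : R -> R) (a eps : R) :
  0 < eps -> filterlim f F (locally a) -> F (fun x => Rabs (f x - a) < eps).
Proof. intros He Hf. apply (Hf (fun y => Rabs (y - a) < eps)). now exists (mkposreal _ He). Qed.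

Lemma converges_to_cylinder (k : R) (u : R -> R) : -1 < k < 0 ->
  (forall x, 0 <= x -> Rbar_lt x (max_radius k) -> u x = Phi k (x ^ 2)) ->
  converges_to_surface (max_radius k) (rot_surface u) (vertical_cylinder (sqrt (- / k))).
Proof.
  intros Hk uPhi.
  assert (r_dom : forall x, 0 <= x -> Rbar_lt x (max_radius k) -> dom k (x ^ 2))
    by (intros x Hx; now apply lt_max_radius).
  assert (Er : max_radius k = sqrt (- / k)) by (unfold max_radius; destruct (Rlt_dec k 0); [easy | lra]).
  assert (Hi : 0 < - / k) by (apply Ropp_0_gt_lt_contravar, Rinv_lt_0_compat; lra).
  pose proof (sqrt_lt_R0 _ Hi) as Hr. set (rho := sqrt (- / k)) in *.
  (* On the surface, [y] is the angle function w^(-1/2), [K] the Gauss curvature w^(-(k + 1)) and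
     [h] the curvature of the parallels, all written with w = (1 + k x^2)^(1/k). The numerator of
     [h] is the horizontal length of the unit normal. *)
  set (y x := exp (- / (2 * k) * ln (1 + k * x ^ 2))).
  set (K x := exp (- ((k + 1) / k) * ln (1 + k * x ^ 2))).
  set (h x := sqrt (1 - y x ^ 2) * / x).
  assert (Ly : filterlim y (at_left rho) (locally 0)).
  { apply filterlim_exp_ln_left; [lra |].
    apply Ropp_0_gt_lt_contravar, Rinv_lt_0_compat; lra. }
  (* Here -1 < k, that is alpha > 0, makes the exponent -(k + 1) / k positive. *)
  assert (LK : filterlim K (at_left rho) (locally 0)).
  { apply filterlim_exp_ln_left; [lra |]. unfold Rdiv.
    rewrite Ropp_mult_distr_r. apply Rmult_lt_0_compat; lra. }
  assert (Lx : filterlim (fun x : R => x) (at_left rho) (locally rho)).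
  { intros P HP. unfold filtermap, at_left, within. revert HP. apply filter_imp. auto. }
  assert (Ls : filterlim (fun x => sqrt (1 - y x ^ 2)) (at_left rho) (locally 1)).
  { pose proof (filterlim_continuous y (fun y => sqrt (1 - y ^ 2)) 0 Ly) as G. cbv beta in G.
    rewrite pow_i, Rminus_0_r, sqrt_1 in G by auto. apply G. auto_derive. lra. }
  assert (Lh : filterlim h (at_left rho) (locally (/ rho))).
  { rewrite <- (Rmult_1_l (/ rho)). apply filterlim_Rmult_real; [easy |].
    apply (filterlim_continuous (fun x => x) Rinv); [easy |]. auto_derive. lra. }
  assert (LH : filterlim (fun x => h x * / 2 + K x * / (2 * h x)) (at_left rho) (locally (/ (2 * rho)))).
  { replace (/ (2 * rho)) with (/ rho * / 2 + 0 * / (2 * / rho)) by (field; lra).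
    apply filterlim_Rplus_real; apply filterlim_Rmult_real; try easy; [apply filterlim_const |].
    apply (filterlim_continuous h (fun h => / (2 * h))); [easy |].
    auto_derive. apply Rmult_integral_contrapositive_currified; [lra |].
    apply Rinv_neq_0_compat; lra. }
  (* This is the distance between the two unit normals: with S = sqrt (1 - y^2), (1 - S)^2 + y^2 = 2
     - 2 S. *)
  assert (LN : filterlim (fun x => sqrt (2 - 2 * sqrt (1 - y x ^ 2))) (at_left rho) (locally 0)).
  { replace 0 with (sqrt (2 - 2 * 1)) by (rewrite <- sqrt_0; f_equal; ring).
    apply (filterlim_comp _ _ _ (fun x => 2 - 2 * sqrt (1 - y x ^ 2)) sqrt _ (locally (2 - 2 * 1)));
      [| apply continuous_sqrt].
    apply (filterlim_continuous (fun x => sqrt (1 - y x ^ 2)) (fun s => 2 - 2 * s)); [easy |].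
    auto_derive. easy. }
  intros eps Heps. rewrite Er.
  assert (N : at_left rho (fun x => 0 < x /\ Rabs (x - rho) < eps /\
    Rabs (sqrt (2 - 2 * sqrt (1 - y x ^ 2)) - 0) < eps /\ Rabs (K x - 0) < eps /\
    Rabs (h x * / 2 + K x * / (2 * h x) - / (2 * rho)) < eps)).
  { apply filter_and; [apply (Lx (fun x => 0 < x)); now apply open_gt |].
    repeat apply filter_and; now apply (fun f => eventually_near f). }
  destruct N as [d Hd]. exists (rho - d).
  split; [simpl; pose proof (cond_pos d); lra |].
  intros a b Hab Hs. set (x := sqrt (a ^ 2 + b ^ 2)) in *.
  assert (Hx : x < rho) by exact Hab.
  rewrite <- Er in Hab.
  destruct (Hd x) as (x0 & H1 & H2 & H3 & H4); [| easy |].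
  { unfold ball; simpl; unfold AbsRing_ball, abs, minus, plus, opp; simpl.
    rewrite Rabs_left; lra. }
  assert (Ex : x ^ 2 = a ^ 2 + b ^ 2) by (apply pow2_sqrt; nra).
  destruct (unit_circle_angle (a / x) (b / x)) as (th & Ec & Es).
  { replace ((a / x) ^ 2 + (b / x) ^ 2) with ((a ^ 2 + b ^ 2) / x ^ 2) by (field; lra).
    rewrite <- Ex. field. lra. }
  assert (Ea : a = x * cos th) by (rewrite Ec; field; lra).
  assert (Eb : b = x * sin th) by (rewrite Es; field; lra).
  assert (Hd' : dom k (x ^ 2)) by (rewrite Ex; now apply (disc_dom k (max_radius k))).
  pose proof (slope_pos k _ Hd') as Hq. pose proof (W_pos k (x ^ 2)) as HW.
  assert (Ey : / sqrt (W k (x ^ 2)) = y x).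
  { rewrite <- Rpower_sqrt, <- Rpower_Ropp by easy. unfold Rpower, y, W, lnW. rewrite ln_exp.
    destruct (Req_EM_T k 0); [lra |]. f_equal. field. easy. }
  assert (EK : Rpower (/ sqrt (W k (x ^ 2))) (2 * (k + 1)) = K x).
  { rewrite Rpower_inv_sqrt by easy. unfold K, W, lnW. rewrite ln_exp.
    destruct (Req_EM_T k 0); [lra |]. f_equal. field. easy. }
  assert (Eh : slope k (x ^ 2) / sqrt (W k (x ^ 2)) = h x).
  { unfold Rdiv. rewrite Ey. unfold h.
    assert (Hy : 0 < y x) by apply exp_pos.
    replace (1 - y x ^ 2) with (Rsqr (x * slope k (x ^ 2) * y x)).
    - rewrite sqrt_Rsqr by (apply Rmult_le_pos; [apply Rmult_le_pos |]; lra). field. lra.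
    - assert (Eyy : y x ^ 2 * W k (x ^ 2) = 1).
      { rewrite <- Ey. rewrite <- (pow2_sqrt (W k (x ^ 2))) at 2 by lra. field.
        apply Rgt_not_eq, sqrt_lt_R0; lra. }
      rewrite W_eq_slope in Eyy by easy. unfold Rsqr. lra. }
  pose proof (sin2_cos2 th) as T. unfold Rsqr in T.
  (* The cylinder point at the same height and angle, hence at horizontal distance rho - x. *)
  exists (u x), th. split; [| split; [| split]].
  - unfold norm3, vsub, rot_surface, vertical_cylinder, dot, px, py, pz; cbn [fst snd].
    fold x. rewrite Ea, Eb. rewrite <- sqrt_Rsqr_abs in H1.
    replace (_ + _) with (Rsqr (x - rho)); [easy |].
    unfold Rsqr. transitivity ((x - rho) * (x - rho) * (sin th * sin th + cos th * cos th));
      [rewrite T; ring | ring].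
  - rewrite (gauss_map_Phi k (max_radius k) u r_dom uPhi a b Hab), gauss_map_cylinder by easy.
    rewrite <- Ex, Eh, Ey.
    unfold norm3, vsub, dot, px, py, pz; cbn [fst snd].
    rewrite Rminus_0_r, Rabs_pos_eq in H2 by apply sqrt_pos.
    replace (_ + _) with (2 - 2 * sqrt (1 - y x ^ 2)); [easy |].
    set (Sq := sqrt (1 - y x ^ 2)) in *.
    assert (EhS : x * h x = Sq) by (unfold h; fold Sq; field; lra).
    assert (E2 : Sq ^ 2 = 1 - y x ^ 2).
    { apply pow2_sqrt. rewrite <- Ey.
      assert (1 <= sqrt (W k (x ^ 2))).
      { rewrite <- sqrt_1. apply sqrt_le_1_alt. rewrite W_eq_slope by easy. nra. }
      assert (0 < / sqrt (W k (x ^ 2)) <= 1).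
      { split; [apply Rinv_0_lt_compat; lra |]. rewrite <- Rinv_1. apply Rinv_le_contravar; lra. }
      nra. }
    rewrite Ea, Eb at 1.
    transitivity ((1 - x * h x) ^ 2 * (sin th * sin th + cos th * cos th) + y x ^ 2);
      [rewrite T, EhS; lra |].
    rewrite Ea, Eb. ring.
  - rewrite (gauss_curvature_Phi k (max_radius k) u r_dom uPhi a b Hab), gauss_curvature_cylinder.
    now rewrite <- Ex, EK.
  - rewrite (mean_curvature_Phi k (max_radius k) u r_dom uPhi a b Hab), mean_curvature_cylinder by easy.
    now rewrite <- Ex, EK, Eh.
Qed.

(** Integrating w' = 2 x w^(1 - k) fixes the constants of the integrands: w = exp (x^2) for alpha =
    2, and for alpha < 2 the exponent 1 / k = - 2 / (2 - alpha). So exp (t^2) and the exponent 2 /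
    (2 - alpha) stand here where the statement in words has exp (t^2 / 2) and (2 - alpha) / 2. *)
Theorem proposition4p2 (alpha : R) (halpha : 0 < alpha) :
  (exists (r : Rbar) (u : R -> R),
     maximal_rotational_K_graph (fun y => Rpower y alpha) r u) /\
  forall (r : Rbar) (u : R -> R),
    maximal_rotational_K_graph (fun y => Rpower y alpha) r u ->
    (2 < alpha ->
       (forall x, 0 <= x -> Rbar_lt (Finite x) r) /\
       (forall x, 0 <= x ->
          is_RInt (fun t => sqrt (Rpower ((alpha - 2) / 2 * t ^ 2 + 1) (2 / (alpha - 2)) - 1))
            0 x (u x)) /\
       entire_graph (axis_disc r) (rot_surface u) /\
       (exists C : R, 0 < C /\
          is_lim (fun x => u x / Rpower x (alpha / (alpha - 2))) p_infty (Finite C))) /\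
    (alpha = 2 ->
       (forall x, 0 <= x -> Rbar_lt (Finite x) r) /\
       (forall x, 0 <= x ->
          is_RInt (fun t => sqrt (exp (t ^ 2) - 1)) 0 x (u x)) /\
       entire_graph (axis_disc r) (rot_surface u)) /\
    (alpha < 2 ->
       let Ralpha := 1 / (2 - alpha) in
       r = Finite (sqrt (2 * Ralpha)) /\
       (forall x, 0 <= x < sqrt (2 * Ralpha) ->
          is_RInt (fun t => sqrt (Rpower (2 * Ralpha / (2 * Ralpha - t ^ 2)) (2 / (2 - alpha)) - 1))
            0 x (u x)) /\
       converges_to_surface r (rot_surface u) (vertical_cylinder (sqrt (2 * Ralpha)))).
Proof.
  assert (Ek : exists k, alpha = 2 * (k + 1)) by (exists ((alpha - 2) / 2); field).
  destruct Ek as [k ->].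
  split; [eexists; eexists; apply maximal_rotational_K_graph_Phi |].
  intros r u Hmax. pose proof (maximal_rotational_K_graph_radius k r u Hmax) as ->.
  assert (uPhi : forall x, 0 <= x -> Rbar_lt x (max_radius k) -> u x = Phi k (x ^ 2))
    by (intros x; apply profile_eq_Phi, Hmax).
  assert (I : forall x, 0 <= x -> Rbar_lt x (max_radius k) ->
    is_RInt (fun t => sqrt (W k (t ^ 2) - 1)) 0 x (u x)).
  { intros x Hx Hr. rewrite uPhi by easy. apply is_RInt_Phi; [easy | now apply lt_max_radius]. }
  assert (Hinf : 0 <= k -> max_radius k = p_infty)
    by (intros Hk; unfold max_radius; destruct (Rlt_dec k 0); [lra | easy]).
  split; [| split].
  - intros Hk. assert (Hr : max_radius k = p_infty) by (apply Hinf; lra). rewrite Hr in *.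
    split; [easy | split; [| split; [split |]]].
    + intros x Hx. apply (is_RInt_ext (fun t => sqrt (W k (t ^ 2) - 1))); [| now apply I]. intros t _.
      rewrite W_Rpower by lra. do 3 f_equal; [field | field; lra].
    + easy.
    + now exists (fun a b => u (sqrt (a ^ 2 + b ^ 2))).
    + exists (sqrt (exp (1 / k * ln k)) / ((k + 1) / k)). split.
      * apply Rdiv_lt_0_compat; [apply sqrt_lt_R0, exp_pos | apply Rdiv_lt_0_compat; lra].
      * eapply is_lim_ext_loc; [| apply is_lim_Phi_div; lra].
        exists 0. intros x Hx. rewrite uPhi by (lra || easy). do 2 f_equal. field. lra.
  - intros Hk. assert (k = 0) as -> by lra. rewrite Hinf in * by lra.
    split; [easy | split; [| split]].
    + intros x Hx. apply (is_RInt_ext (fun t => sqrt (W 0 (t ^ 2) - 1))); [| now apply I]. intros t _.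
      unfold W, lnW. destruct (Req_EM_T 0 0); [easy | lra].
    + easy.
    + now exists (fun a b => u (sqrt (a ^ 2 + b ^ 2))).
  - intros Hk Ralpha.
    (* Since k = - (2 - alpha) / 2, the squared limit radius - 1 / k is 2 R_alpha. *)
    assert (ER : 2 * Ralpha = - / k) by (unfold Ralpha; field; lra).
    rewrite ER.
    assert (Er : max_radius k = sqrt (- / k))
      by (unfold max_radius; destruct (Rlt_dec k 0); [easy | lra]).
    split; [easy | split].
    + intros x [Hx Hxr]. assert (Hr : Rbar_lt x (max_radius k)) by now rewrite Er.
      apply (is_RInt_ext (fun t => sqrt (W k (t ^ 2) - 1))); [| now apply I]. intros t Ht.
      rewrite Rmin_left, Rmax_right in Ht by lra.
      assert (Hd : dom k (t ^ 2)).
      { apply lt_max_radius; [lra |]. rewrite Er. simpl. lra. }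
      unfold dom in Hd. rewrite W_Rpower by lra. do 2 f_equal.
      (* The base is the inverse of 1 + k t^2, which turns the negative exponent 1 / k into the
         positive 2 / (2 - alpha). *)
      replace (- / k / (- / k - t ^ 2)) with (/ (1 + k * t ^ 2)) by (field; lra).
      unfold Rpower. rewrite ln_Rinv by easy. f_equal. field. lra.
    + apply converges_to_cylinder; [lra | easy].
Qed.
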